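(* Let $M>0$, let $n\ge 3$, and let $\mathcal{J}\subseteq\{J:\|J\|_\infty\le M\}$ be a collection of $n\times n$ interaction matrices. There is an algorithm which, for every $\delta\in(0,1)$, given a single sample $x\sim\Pr_{J^*}$ where $J^*\in\mathcal{J}$ is unknown, outputs $\hat J=\hat J(x)$ such that with probability at least $1-\delta$, $$\|\hat J-J^*\|_F\le C(M)\sqrt{\log N(\mathcal{J},\|\cdot\|_2,1/n)+\log(1/\delta)+\log\log n},$$ where $C(M)$ is a (singly) exponential function of $M$. Moreover, $\hat J$ is the minimizer over $\mathcal{J}$ of a convex function on the space of matrices $\mathbb{R}^{n\times n}$. It can be computed in polynomial time if $\mathcal{J}$ is convex and projection onto $\mathcal{J}$ is efficiently computable.
   Context: An interaction matrix is a real symmetric $n\times n$ matrix $J$ with zero diagonal. The Ising model $\Pr_J$ is the distribution on $\{\pm1\}^n$ with $\Pr_J[x]\propto\exp(x^\top Jx/2)$. Norms: $\|J\|_\infty=\max_i\sum_j|J_{ij}|$, $\|J\|_F$ is the Frobenius norm, $\|J\|_2$ is the spectral norm. For a subset $\mathcal{V}$ of a normed space, an $\epsilon$-cover of $\mathcal{V}$ is a set $\mathcal{N}\subseteq\mathcal{V}$ such that every $v\in\mathcal{V}$ has some $u\in\mathcal{N}$ with $\|u-v\|\le\epsilon$; $N(\mathcal{V},\|\cdot\|,\epsilon)$ is the minimum cardinality of an $\epsilon$-cover. ''Singly exponential'' means bounded by $ae^{bM}$ for universal constants $a,b>0$. Computing the minimizer is understood up to optimization accuracy (additive error $\epsilon$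 in the objective value, in time also polynomial in $1/\epsilon$). *)

(* Defs.v *)
From mathcomp Require Export all_boot all_order all_algebra.
From mathcomp Require Export all_classical all_reals all_analysis.

Set Implicit Arguments.
Unset Strict Implicit.
Unset Printing Implicit Defensive.

Import Order.TTheory GRing.Theory Num.Theory.

Local Open Scope classical_set_scope.
Local Open Scope ring_scope.

Section norms.
Variable R : realType.

Definition l2norm (n : nat) (v : 'cV[R]_n) : R :=
  Num.sqrt (\sum_i v i 0 ^+ 2).

Definition frobenius_norm (n : nat) (A : 'M[R]_n) : R :=
  Num.sqrt (\sum_i \sum_j A i j ^+ 2).

Definition spectral_norm (n : nat) (A : 'M[R]_n) : R :=
  sup [set l2norm (A *m v) | v in [set v : 'cV[R]_n | l2norm v <= 1]].

Definition infinity_norm (n : nat) (A : 'M[R]_n) : R :=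
  \big[Num.max/0]_(i < n) \sum_j `|A i j|.

Definition eps_cover (V : zmodType) (norm : V -> R) (A : set V) (eps : R)
    (N : set V) : Prop :=
  N `<=` A /\ forall v, A v -> exists2 u, N u & norm (u - v) <= eps.

(* Only finite covers are considered; the value is 0 by convention when there
   is none, which does not happen for a bounded set of matrices and eps > 0. *)
Definition covering_number (V : zmodType) (norm : V -> R) (A : set V)
    (eps : R) : nat :=
  let covered_by k :=
    exists2 N : set V, (N #= `I_k)%card & eps_cover norm A eps N in
  xget 0%N [set k | covered_by k /\ forall m, covered_by m -> (k <= m)%N].

End norms.

Section ising.
Variable R : realType.

(* A configuration of n spins; [true] stands for the spin -1. *)
Definition config (n : nat) := {ffun 'I_n -> bool}.

Definition spin (n : nat) (x : config n) : 'cV[R]_n := \col_i (-1) ^+ x i.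

Definition interaction_matrix (n : nat) (J : 'M[R]_n) : Prop :=
  J^T = J /\ forall i, J i i = 0.

Definition ising_weight (n : nat) (J : 'M[R]_n) (x : config n) : R :=
  expR (((spin x)^T *m J *m spin x) 0 0 / 2).

Definition ising_prob (n : nat) (J : 'M[R]_n) (E : pred (config n)) : R :=
  (\sum_(x | E x) ising_weight J x) / \sum_x ising_weight J x.

Definition singly_exponential (C : R -> R) : Prop :=
  exists a b : R, [/\ 0 < a, 0 < b & forall M, 0 < M -> C M <= a * expR (b * M)].

End ising.

Section optimization.
Variables (R : realType) (T : Type).

Definition minimizer (f : T -> R) (A : set T) (v : T) : Prop :=
  A v /\ forall u, A u -> f v <= f u.

Definition near_minimizer (eps : R) (f : T -> R) (A : set T) (v : T) : Prop :=
  A v /\ forall u, A u -> f v <= f u + eps.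

End optimization.

Definition projection_onto (R : realType) (n : nat) (A : set 'M[R]_n)
    (P : 'M[R]_n -> 'M[R]_n) : Prop :=
  forall B, minimizer (fun D => frobenius_norm (D - B)) A (P B).

(* A uniform model of computation over the reals with a projection oracle: a
   program is a finite piece of syntax, independent of n and of the data, that
   manipulates natural-number registers (used for counting and addressing) and
   two-dimensional arrays of exact reals.  The only constants are natural
   numbers and the only real operations are the field operations, with
   x / 0 = 0, and comparison; there is no rounding and no transcendental
   function.  A real scalar is stored in the cell (0, 0) of an array. *)

Inductive nat_expr :=
| NConst of nat
| NReg of nat
| NAdd of nat_expr & nat_expr.

Inductive real_expr :=
| RNat of nat_expr
| RCell of nat & nat_expr & nat_expr
| RAdd of real_expr & real_expr
| RSub of real_expr & real_expr
| RMul of real_expr & real_expr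
| RDiv of real_expr & real_expr.

Inductive test :=
| TNatLt of nat_expr & nat_expr
| TRealLt of real_expr & real_expr.

Inductive program :=
| Skip
| SetReg of nat & nat_expr
| SetCell of nat & nat_expr & nat_expr & real_expr
| Seq of program & program
| If of test & program & program
| While of test & program
| Project of nat.

Section semantics.
Variable R : realType.

Record store := Store {
  reg : nat -> nat;
  cell : nat -> nat -> nat -> R
}.

Fixpoint eval_nat (s : store) (e : nat_expr) : nat :=
  match e with
  | NConst k => k
  | NReg r => reg s r
  | NAdd e1 e2 => (eval_nat s e1 + eval_nat s e2)%N
  end.

Fixpoint eval_real (s : store) (e : real_expr) : R :=
  match e with
  | RNat k => (eval_nat s k)%:R
  | RCell a i j => cell s a (eval_nat s i) (eval_nat s j)
  | RAdd e1 e2 => eval_real s e1 + eval_real s e2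
  | RSub e1 e2 => eval_real s e1 - eval_real s e2
  | RMul e1 e2 => eval_real s e1 * eval_real s e2
  | RDiv e1 e2 => eval_real s e1 / eval_real s e2
  end.

Definition eval_test (s : store) (c : test) : bool :=
  match c with
  | TNatLt e1 e2 => (eval_nat s e1 < eval_nat s e2)%N
  | TRealLt e1 e2 => eval_real s e1 < eval_real s e2
  end.

Definition set_reg (s : store) (r k : nat) : store :=
  Store (fun r' => if r' == r then k else reg s r') (cell s).

Definition set_cell (s : store) (a i j : nat) (v : R) : store :=
  Store (reg s) (fun a' i' j' =>
    if [&& a' == a, i' == i & j' == j] then v else cell s a' i' j').

Definition read_matrix (n : nat) (s : store) (a : nat) : 'M[R]_n :=
  \matrix_(i, j) cell s a i j.

Definition write_matrix (n : nat) (s : store) (a : nat) (A : 'M[R]_n) : store :=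
  Store (reg s) (fun a' i j =>
    if a' == a then
      match insub i : option 'I_n, insub j : option 'I_n with
      | Some i', Some j' => A i' j'
      | _, _ => cell s a' i j
      end
    else cell s a' i j).

(* [exec P tau c s t s']: from the store s, the program c halts in time t with
   the store s'.  An assignment or a test takes one unit of time (the
   expressions of a fixed program have bounded size); a call to the routine
   computing P takes tau more. *)
Inductive exec (n : nat) (P : 'M[R]_n -> 'M[R]_n) (tau : nat) :
    program -> store -> nat -> store -> Prop :=
| exec_skip s : exec P tau Skip s 1 s
| exec_set_reg s r e :
    exec P tau (SetReg r e) s 1 (set_reg s r (eval_nat s e))
| exec_set_cell s a i j e :
    exec P tau (SetCell a i j e) s 1
      (set_cell s a (eval_nat s i) (eval_nat s j) (eval_real s e))
| exec_seq c1 c2 s1 s2 s3 t1 t2 :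
    exec P tau c1 s1 t1 s2 -> exec P tau c2 s2 t2 s3 ->
    exec P tau (Seq c1 c2) s1 (t1 + t2)%N s3
| exec_if_true b c1 c2 s s' t :
    eval_test s b -> exec P tau c1 s t s' -> exec P tau (If b c1 c2) s t.+1 s'
| exec_if_false b c1 c2 s s' t :
    ~~ eval_test s b -> exec P tau c2 s t s' -> exec P tau (If b c1 c2) s t.+1 s'
| exec_while_true b c s1 s2 s3 t1 t2 :
    eval_test s1 b -> exec P tau c s1 t1 s2 -> exec P tau (While b c) s2 t2 s3 ->
    exec P tau (While b c) s1 (t1 + t2).+1 s3
| exec_while_false b c s :
    ~~ eval_test s b -> exec P tau (While b c) s 1 s
| exec_project s a :
    exec P tau (Project a) s tau.+1 (write_matrix s a (P (read_matrix n s a))).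

(* Calling convention: n is in register 0, M and the accuracy eps are the cells
   (0, 0) of the arrays 0 and 1, the sample is column 0 of array 2, and the
   result is expected in array 3. *)
Definition initial_store (n : nat) (M eps : R) (x : config n) : store :=
  Store (fun r => if r == 0%N then n else 0%N)
    (fun a i j =>
      if [&& a == 0, i == 0 & j == 0]%N then M
      else if [&& a == 1, i == 0 & j == 0]%N then eps
      else if (a == 2)%N && (j == 0)%N then
        if insub i : option 'I_n is Some k then spin R x k 0 else 0
      else 0).

Definition result (n : nat) (s : store) : 'M[R]_n := read_matrix n s 3.

End semantics.

(* Main.v *)
Require Import Defs.
From mathcomp Require Import ring lra zify.

Set Implicit Arguments.
Unset Strict Implicit.
Unset Printing Implicit Defensive.

Import Order.TTheory GRing.Theory Num.Theory.

Local Open Scope classical_set_scope.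
Local Open Scope ring_scope.

(** The estimator minimizes the negative log-pseudo-likelihood
    [pseudo_loss x J], the sum over the sites [i] of
    [ln (1 + exp (- 2 x_i (J x)_i))], a convex function of [J].

    Statistics.  Write [J] for the true matrix, [A = K - J] for a perturbation,
    [g] for the vector of scores [x_i / (1 + exp (2 x_i (J x)_i))] and [F] for
    the squared Frobenius norm of [A].  Strong convexity of the logistic loss on
    bounded fields bounds the loss difference between [K] and [J] below by
    [H = - 2 <g, A x> + 4 k |A x|^2] ([excess_le_pseudo_loss]).  The lower
    tail of [H] is controlled through the law tilted by [exp (- lam H)]: by
    Jensen's inequality the exponential moment of [- lam H] is at most
    [exp (- lam E H)], with [E] the tilted mean, so it suffices that
    [E H >= c F] ([expect_excess_ge]).

    The mean is bounded by means of one identity.  The score [g_i] is antisymmetric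
    under flipping spin [i] with respect to the Ising weight
    ([weight_score_flip]); hence a product [g_i u], with [u] not depending on
    spin [i], has mean zero under the Ising law, and a tilted mean of order
    [lam] times the variation of [H] under the flip ([tilted_score_le]).  As [A]
    has zero diagonal this applies to [<g, A x>], which is therefore small.  It
    applies also to [<A g, A x>] and to [|A g|^2] once the dependence of the
    [i]-th factor on spin [i] is split off: the first is at least of order [F],
    since [x_i g_i] is bounded below, and the second at most of order [F], since
    flipping one spin changes the other scores by the size of their interaction.
    Completing the square, [|A x|^2 >= 2 s <A g, A x> - s^2 |A g|^2] for every
    [s], so [|A x|^2] has mean of order [F], and so has [H].  All the constants
    are powers of [exp M].

    A union bound over a cover at scale [1 / n] in spectral norm ends the
    argument: replacing the estimate by its neighbour in the cover changes the
    loss by at most 2 and moves it by at most 1 in Frobenius norm, and these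
    errors are absorbed because [ln (ln n) >= ln (ln 3) > 0]
    ([near_minimizer_error]).

    Computation.  The program runs projected gradient descent with averaged
    iterates ([average_near_minimizer]).  The gradient of the logistic loss is
    bounded, so polynomially many steps suffice, with no exponential dependence
    on [M]; the exponential function is replaced by [(1 + z / m) ^ m], where [m]
    is also the number of steps ([approx_sigmoid_error]).  The program is
    verified by invariants for its nested counting loops ([algorithm_ok]). *)

(** * The logistic loss *)

Section elementary.
Variable R : realType.
Implicit Types a b z d u y : R.

Lemma ln_le_subr1 y : 0 < y -> ln y <= y - 1.
Proof.
move=> y0; have /(_ (y - 1)) := @le_ln1Dx R.
have -> : 1 + (y - 1) = y by ring.
by move=> h; apply: h; lra.
Qed.

Lemma expR_sub_le a b : `|expR a - expR b| <= `|a - b| * (expR a + expR b).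
Proof.
wlog ab : a b / a <= b.
  move=> H; case: (leP a b) => [/H//|/ltW/H].
  by rewrite distrC [`|b - a|]distrC [expR b + _]addrC.
rewrite distrC [`|a - b|]distrC !ger0_norm ?subr_ge0 ?ler_expR//.
have := expR_ge1Dx (a - b); have -> : expR a = expR b * expR (a - b).
  by rewrite -expRD; congr expR; ring.
have := expR_gt0 b; have := expR_gt0 (a - b); set p := expR _; set q := expR _.
move=> p0 q0 h; have : q * (1 + (a - b)) <= q * p by rewrite ler_pM2l.
have : 0 <= (b - a) * (q * p) by rewrite mulr_ge0 ?subr_ge0// mulr_ge0 ?ltW.
by lra.
Qed.

(** The quadratic gain degrades to a linear one for large [u], which makes the
    bound valid on the whole line, also where the exponential is negligible. *)
Lemma expR_ge_quadratic u : 1 + u + u ^+ 2 / (4 + 2 * `|u|) <= expR u.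
Proof.
have [u0|u0] := leP 0 u.
  have := expR_ge1Dxn 1 u0; rewrite expr2 /= => h.
  apply: le_trans (_ : 1 + u + u ^+ 2 / 4 <= _).
    by rewrite lerD2l ler_wpM2l ?sqr_ge0// lef_pV2 ?posrE; rewrite ?ger0_norm//; lra.
  have := expR_ge1Dx (u / 2) => h2.
  have -> : expR u = expR (u / 2) ^+ 2 by rewrite -expRM_natl; congr expR; field.
  by rewrite expr2; nra.
have nu : `|u| = - u by rewrite ltr0_norm.
have [u2|u2] := leP (-2) u.
  apply: le_trans (_ : 1 + u + u ^+ 2 / 4 <= _).
    by rewrite lerD2l ler_wpM2l ?sqr_ge0// lef_pV2 ?posrE; rewrite ?nu//; lra.
  have := expR_ge1Dx (u / 2) => h2.
  have -> : expR u = expR (u / 2) ^+ 2 by rewrite -expRM_natl; congr expR; field.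
  by rewrite expr2; nra.
apply: le_trans (expR_ge0 u); rewrite nu.
have d0 : 0 < 4 + 2 * (- u) by lra.
have : u ^+ 2 / (4 + 2 * - u) <= - 1 - u.
  by rewrite ler_pdivrMr// expr2; nra.
by lra.
Qed.

Definition softplus z : R := ln (1 + expR z).

Definition sigmoid z : R := (1 + expR (- z))^-1.

Lemma softplus_ge0 z : 0 <= softplus z.
Proof. by rewrite ln_ge0// lerDl expR_ge0. Qed.

Lemma expR1_gt0 z : 0 < 1 + expR z.
Proof. by rewrite addr_gt0 ?expR_gt0. Qed.

Lemma sigmoid_gt0 z : 0 < sigmoid z.
Proof. by rewrite invr_gt0 expR1_gt0. Qed.

Lemma sigmoid_le1 z : sigmoid z <= 1.
Proof. by rewrite invf_le1 ?expR1_gt0// lerDl expR_ge0. Qed.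

Lemma sigmoidN z : sigmoid (- z) = 1 - sigmoid z.
Proof.
rewrite /sigmoid opprK expRN; have := expR_gt0 z; set e := expR z => e0.
by field; rewrite !lt0r_neq0//; lra.
Qed.

Lemma sigmoidV z : (sigmoid (- z)) = (1 + expR z)^-1.
Proof. by rewrite /sigmoid opprK. Qed.

Lemma sigmoid_lipschitz a b : `|sigmoid a - sigmoid b| <= `|a - b|.
Proof.
rewrite /sigmoid; have := expR_sub_le (- a) (- b).
have -> : `|- a - - b| = `|a - b| by rewrite -opprD normrN.
have := expR_gt0 (- a); have := expR_gt0 (- b).
set p := expR (- a); set q := expR (- b) => q0 p0 h.
have -> : (1 + p)^-1 - (1 + q)^-1 = - (p - q) / ((1 + p) * (1 + q)).
  by field; rewrite !lt0r_neq0//; lra.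
rewrite normrM normrN normfV [`|_ * _|]gtr0_norm; last by apply: mulr_gt0; lra.
rewrite ler_pdivrMr; last by apply: mulr_gt0; lra.
apply: le_trans h _; apply: ler_wpM2l => //; nra.
Qed.

(** With [p] the sigmoid at [z], the loss at [z + d] exceeds the loss at [z] by
    the logarithm of [(1 - p) + p * exp d].  The exponential is expanded around
    the mean [p * d]: the linear terms cancel and the quadratic ones add up to a
    multiple of the variance [p * (1 - p) * d ^ 2]. *)
Lemma softplus_ge_quadratic z d :
  softplus z + sigmoid z * d
    + ln (1 + sigmoid z * sigmoid (- z) * (d ^+ 2 / (4 + 2 * `|d|)))
  <= softplus (z + d).
Proof.
set p := sigmoid z; have p0 : 0 < p := sigmoid_gt0 z.
have p1 : p <= 1 := sigmoid_le1 z.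
rewrite sigmoidN -/p; set q := 1 - p; have q0 : 0 <= q by rewrite subr_ge0.
have d0 : 0 < 4 + 2 * `|d| by have := normr_ge0 d; lra.
set c := (4 + 2 * `|d|)^-1; have c0 : 0 < c by rewrite invr_gt0.
have key u : `|u| <= `|d| -> 1 + u + c * u ^+ 2 <= expR u.
  move=> ud; apply: le_trans (expR_ge_quadratic u); rewrite lerD2l mulrC.
  rewrite ler_wpM2l ?sqr_ge0// lef_pV2 ?posrE; last 2 first.
  - done.
  - by have := normr_ge0 u; lra.
  by lra.
have E1 : 1 + expR (z + d) = (1 + expR z) * (q + p * expR d).
  rewrite /q /p /sigmoid expRD expRN; have := expR_gt0 z; set e := expR z => e0.
  by field; rewrite !lt0r_neq0//; lra.
have E2 : expR (p * d) * (1 + p * q * (d ^+ 2 * c)) <= q + p * expR d.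
  have h1 : expR (p * d) * (1 + q * d + c * (q * d) ^+ 2) <= expR d.
    have -> : expR d = expR (p * d) * expR (q * d).
      by rewrite -expRD; congr expR; rewrite /q; ring.
    rewrite ler_pM2l ?expR_gt0//; apply: key; rewrite normrM ger0_norm//.
    by rewrite ler_piMl//; rewrite /q; lra.
  have h2 : expR (p * d) * (1 + - (p * d) + c * (- (p * d)) ^+ 2) <= 1.
    rewrite -[leRHS](expR0 R) -[leRHS in _ <= expR leRHS](subrr (p * d)) expRD.
    rewrite ler_pM2l ?expR_gt0//; apply: key.
    by rewrite normrN normrM (ger0_norm (ltW p0)) ler_piMl.
  have := ler_wpM2l (ltW p0) h1; have := ler_wpM2l q0 h2.
  set e := expR (p * d).
  have -> : e * (1 + p * q * (d ^+ 2 * c))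
     = q * (e * (1 + - (p * d) + c * (- (p * d)) ^+ 2)) +
       p * (e * (1 + q * d + c * (q * d) ^+ 2)) by rewrite /q; ring.
  lra.
have y0 : 0 <= p * q * (d ^+ 2 * c).
  by apply: mulr_ge0; apply: mulr_ge0 => //; rewrite ?sqr_ge0// ltW.
rewrite {2}/softplus E1 lnM ?posrE ?expR1_gt0//; last first.
  by apply: lt_le_trans E2; rewrite mulr_gt0 ?expR_gt0//; lra.
rewrite -addrA lerD2l -[X in X + _]expRK -lnM ?posrE ?expR_gt0//; last by lra.
rewrite ler_ln ?posrE//; first by rewrite mulr_gt0 ?expR_gt0//; lra.
by apply: lt_le_trans E2; rewrite mulr_gt0 ?expR_gt0//; lra.
Qed.

Lemma softplus_ge_tangent z d : softplus z + sigmoid z * d <= softplus (z + d).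
Proof.
apply: le_trans (softplus_ge_quadratic z d); rewrite lerDl ln_ge0// lerDl.
have d0 : 0 < 4 + 2 * `|d| by have := normr_ge0 d; lra.
by apply: mulr_ge0; apply: mulr_ge0; rewrite ?sqr_ge0// ltW ?sigmoid_gt0 ?invr_gt0.
Qed.

Lemma softplus_convex (s : R) a b : 0 <= s -> s <= 1 ->
  softplus (s * a + (1 - s) * b) <= s * softplus a + (1 - s) * softplus b.
Proof.
move=> s0 s1; set m := s * a + _.
have /(ler_wpM2l s0) := softplus_ge_tangent m (a - m).
have s0' : 0 <= 1 - s by lra.
have /(ler_wpM2l s0') := softplus_ge_tangent m (b - m).
rewrite ![m + (_ - m)]addrC !subrK.
have : s * (sigmoid m * (a - m)) + (1 - s) * (sigmoid m * (b - m)) = 0.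
  by rewrite /m; ring.
by lra.
Qed.

Lemma softplus_lipschitz a b : `|softplus a - softplus b| <= `|a - b|.
Proof.
have h u v : softplus u - softplus v <= `|u - v|.
  have := softplus_ge_tangent u (v - u); rewrite [u + _]addrC subrK.
  have : sigmoid u * (u - v) <= `|u - v|.
    apply: le_trans (ler_norm _) _; rewrite normrM (ger0_norm (ltW (sigmoid_gt0 u))).
    by rewrite ler_piMl ?sigmoid_le1.
  by rewrite -opprB mulrN; lra.
by rewrite ler_norml h andbT lerNl opprB distrC h.
Qed.

Lemma ln1D_ge y : 0 <= y -> y / (1 + y) <= ln (1 + y).
Proof.
move=> y0; have p : 0 < 1 + y by lra.
have := @ln_le_subr1 (1 + y)^-1; rewrite invr_gt0 => /(_ p).
rewrite lnV ?posrE// => h.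
have -> : y / (1 + y) = 1 - (1 + y)^-1 by field; rewrite lt0r_neq0.
by lra.
Qed.

(** On the range of the local fields the second derivative of the loss is at least
    a power of [1 / t], where [t] stands for [exp M]. *)
Lemma softplus_strongly_convex (t : R) z d : 1 <= t ->
  expR z <= t ^+ 2 -> expR (- z) <= t ^+ 2 -> `|d| <= 4 * t ->
  softplus z + sigmoid z * d + (144 * t ^+ 4)^-1 * d ^+ 2 <= softplus (z + d).
Proof.
move=> t1 h1 h2 hd; apply: le_trans (softplus_ge_quadratic z d); rewrite lerD2l.
have pq : (4 * t ^+ 2)^-1 <= sigmoid z * sigmoid (- z).
  have p1 : 0 < 4 * t ^+ 2 by rewrite mulr_gt0// exprn_gt0//; lra.
  have p2 := mulr_gt0 (expR1_gt0 (- z)) (expR1_gt0 z).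
  rewrite sigmoidV /sigmoid -invfM lef_pV2 ?posrE//.
  have : expR (- z) * expR z = 1 by rewrite mulrC expRxMexpNx_1.
  have : 1 <= t ^+ 2 by rewrite exprn_ege1.
  by lra.
have pq1 : sigmoid z * sigmoid (- z) <= 1.
  by rewrite mulr_ile1 ?sigmoid_le1// ltW ?sigmoid_gt0.
have nd := normr_ge0 d.
have d2 : d ^+ 2 = `|d| ^+ 2 by rewrite real_normK ?num_real.
set u := sigmoid z * _ in pq pq1 *; set v := d ^+ 2 / _.
have v0 : 0 <= v by rewrite divr_ge0 ?sqr_ge0//; lra.
have vle : v <= 2 * t.
  by rewrite /v d2 ler_pdivrMr; [rewrite expr2; nra | lra].
have vge : d ^+ 2 / (12 * t) <= v.
  by rewrite /v ler_wpM2l ?sqr_ge0// lef_pV2 ?posrE; lra.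
have u0 : 0 <= u by rewrite mulr_ge0// ltW ?sigmoid_gt0.
apply: le_trans (ln1D_ge (mulr_ge0 u0 v0)).
have uv : u * v <= 2 * t by apply: le_trans vle; rewrite ler_piMl.
rewrite ler_pdivlMr; last by have := mulr_ge0 u0 v0; lra.
have t0 : 0 < t by lra.
have e1 : (4 * t ^+ 2)^-1 * (d ^+ 2 / (12 * t)) <= u * v.
  apply: ler_pM => //.
    by rewrite invr_ge0; apply: mulr_ge0; rewrite ?sqr_ge0.
  by apply: divr_ge0; rewrite ?sqr_ge0//; lra.
apply: le_trans e1; apply: le_trans (_ : (144 * t ^+ 4)^-1 * d ^+ 2 * (3 * t) <= _).
  apply: ler_wpM2l; last by lra.
  by apply: mulr_ge0; rewrite ?sqr_ge0// invr_ge0 mulr_ge0// exprn_ge0// ltW.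
by rewrite le_eqVlt; apply/orP; left; apply/eqP; field; rewrite lt0r_neq0.
Qed.

Lemma half_difference_swap (p q : R) : q - (q - p) / 2 = p - (p - q) / 2.
Proof. by field. Qed.

Lemma monomial_gt0 (c m : nat) (t : R) : (0 < c)%N -> 0 < t -> 0 < c%:R * t ^+ m.
Proof. by move=> c0 t0; rewrite mulr_gt0 ?ltr0n ?exprn_gt0. Qed.

Lemma cancel_factors (d p a u : R) : d != 0 -> p != 0 -> a != 0 -> u != 0 ->
  (d * p * (a * u))^-1 * a * u * p = d^-1.
Proof. by move=> d0 p0 a0 u0; field; rewrite u0 a0 p0 d0. Qed.

Lemma sqr_sum6_le (c1 c2 c3 c4 c5 c6 : R) :
  (c1 + c2 + c3 + c4 + c5 + c6) ^+ 2 <=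
  6 * (c1 ^+ 2 + c2 ^+ 2 + c3 ^+ 2 + c4 ^+ 2 + c5 ^+ 2 + c6 ^+ 2).
Proof.
have := sqr_ge0 (c1 - c2); have := sqr_ge0 (c1 - c3); have := sqr_ge0 (c1 - c4).
have := sqr_ge0 (c1 - c5); have := sqr_ge0 (c1 - c6); have := sqr_ge0 (c2 - c3).
have := sqr_ge0 (c2 - c4); have := sqr_ge0 (c2 - c5); have := sqr_ge0 (c2 - c6).
have := sqr_ge0 (c3 - c4); have := sqr_ge0 (c3 - c5); have := sqr_ge0 (c3 - c6).
have := sqr_ge0 (c4 - c5); have := sqr_ge0 (c4 - c6); have := sqr_ge0 (c5 - c6).
by rewrite !expr2; lra.
Qed.

End elementary.

(** * Sums, vectors and matrices *)

Section sums.
Variables (R : realType) (I : finType).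
Implicit Types (a b v : I -> R) (K : I -> I -> R).

Lemma sqr_weighted_sum_le a v : (forall i, 0 <= a i) ->
  (\sum_i a i * v i) ^+ 2 <= (\sum_i a i) * \sum_i a i * v i ^+ 2.
Proof.
move=> a0; rewrite expr2 !big_distrlr/=.
have -> : \sum_i \sum_j a i * (a j * v j ^+ 2) =
    2^-1 * \sum_i \sum_j a i * a j * (v i ^+ 2 + v j ^+ 2).
  have e : \sum_i \sum_j a i * a j * (v i ^+ 2 + v j ^+ 2)
     = \sum_i \sum_j a i * (a j * v j ^+ 2) + \sum_i \sum_j a i * (a j * v j ^+ 2).
    rewrite [X in _ = X + _]exchange_big/= -big_split/=; apply: eq_bigr => i _.
    by rewrite -big_split/=; apply: eq_bigr => j _; ring.
  by rewrite e; field.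
rewrite mulr_sumr ler_sum// => i _; rewrite mulr_sumr ler_sum// => j _.
have := mulr_ge0 (mulr_ge0 (a0 i) (a0 j)) (sqr_ge0 (v i - v j)).
rewrite sqrrB; lra.
Qed.

Lemma cauchy_schwarz_sum a b :
  (\sum_i a i * b i) ^+ 2 <= (\sum_i a i ^+ 2) * \sum_i b i ^+ 2.
Proof.
rewrite expr2 !big_distrlr/=.
have -> : \sum_i \sum_j a i ^+ 2 * b j ^+ 2 =
    2^-1 * \sum_i \sum_j (a i ^+ 2 * b j ^+ 2 + a j ^+ 2 * b i ^+ 2).
  have e : \sum_i \sum_j (a i ^+ 2 * b j ^+ 2 + a j ^+ 2 * b i ^+ 2)
     = \sum_i \sum_j a i ^+ 2 * b j ^+ 2 + \sum_i \sum_j a i ^+ 2 * b j ^+ 2.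
    rewrite [X in _ = X + _]exchange_big/= -big_split/=; apply: eq_bigr => i _.
    by rewrite -big_split/=; apply: eq_bigr => j _; ring.
  by rewrite e; field.
rewrite mulr_sumr ler_sum// => i _; rewrite mulr_sumr ler_sum// => j _.
have := sqr_ge0 (a i * b j - a j * b i).
by rewrite sqrrB !exprMn; lra.
Qed.

(** Cauchy-Schwarz with the weights [K i j] in each row, then the column sums. *)
Lemma schur_test K v m : (forall i j, 0 <= K i j) ->
  (forall i, \sum_j K i j <= m) -> (forall j, \sum_i K i j <= m) ->
  \sum_i (\sum_j K i j * v j) ^+ 2 <= m ^+ 2 * \sum_j v j ^+ 2.
Proof.
move=> K0 rK cK.
apply: le_trans (_ : \sum_i m * \sum_j K i j * v j ^+ 2 <= _).
  apply: ler_sum => i _; apply: le_trans (sqr_weighted_sum_le _ (K0 i)) _.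
  by apply: ler_wpM2r => //; apply: sumr_ge0 => j _; rewrite mulr_ge0 ?sqr_ge0.
rewrite -mulr_sumr exchange_big/= expr2 -mulrA.
rewrite !mulr_sumr; apply: ler_sum => j _.
have m0 : 0 <= m by apply: le_trans (rK j); apply: sumr_ge0.
by rewrite -mulr_suml ler_wpM2l// ler_wpM2r ?sqr_ge0.
Qed.

Lemma sum_sqr_le_sqr_sum v : (forall i, 0 <= v i) ->
  \sum_i v i ^+ 2 <= (\sum_i v i) ^+ 2.
Proof.
move=> v0; rewrite [leRHS]expr2 mulr_suml; apply: ler_sum => i _.
rewrite expr2 ler_wpM2l// (bigD1 i)//= lerDl.
by apply: sumr_ge0.
Qed.

End sums.

Section vectors.
Variables (R : realType) (n : nat).
Implicit Types (u v : 'cV[R]_n) (A : 'M[R]_n).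

Definition dot u v : R := \sum_i u i 0 * v i 0.

Definition sqnorm v : R := \sum_i v i 0 ^+ 2.

Lemma sqnorm_ge0 v : 0 <= sqnorm v.
Proof. by apply: sumr_ge0 => i _; exact: sqr_ge0. Qed.

Lemma sqnormE v : sqnorm v = dot v v.
Proof. by apply: eq_bigr => i _; rewrite expr2. Qed.

Lemma dotC u v : dot u v = dot v u.
Proof. by apply: eq_bigr => i _; rewrite mulrC. Qed.

Lemma dotDl u v w : dot (u + v) w = dot u w + dot v w.
Proof. by rewrite -big_split; apply: eq_bigr => i _; rewrite mxE mulrDl. Qed.

Lemma dotDr u v w : dot u (v + w) = dot u v + dot u w.
Proof. by rewrite dotC dotDl !(dotC u). Qed.

Lemma dotNl u v : dot (- u) v = - dot u v.
Proof. by rewrite -sumrN; apply: eq_bigr => i _; rewrite mxE mulNr. Qed.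

Lemma dotNr u v : dot u (- v) = - dot u v.
Proof. by rewrite dotC dotNl dotC. Qed.

Lemma dotZl c u v : dot (c *: u) v = c * dot u v.
Proof. by rewrite mulr_sumr; apply: eq_bigr => i _; rewrite mxE mulrA. Qed.

Lemma dotZr c u v : dot u (c *: v) = c * dot u v.
Proof. by rewrite dotC dotZl dotC. Qed.

Lemma dot_mulmx A u v : A^T = A -> dot (A *m u) v = dot u (A *m v).
Proof.
move=> sA; rewrite /dot.
under eq_bigr do rewrite mxE mulr_suml.
rewrite exchange_big/=; apply: eq_bigr => j _.
rewrite mxE mulr_sumr; apply: eq_bigr => i _.
by rewrite -{1}sA mxE; ring.
Qed.

Lemma dot_delta u i : dot u (delta_mx i 0) = u i 0.
Proof.
rewrite /dot (bigD1 i)//= big1 => [|j ji]; rewrite mxE eqxx ?mulr1 ?addr0//.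
by rewrite (negPf ji) mulr0.
Qed.

Lemma colD (u v : 'cV[R]_n) i : (u + v) i 0 = u i 0 + v i 0.
Proof. by rewrite mxE. Qed.

Lemma colB (u v : 'cV[R]_n) i : (u - v) i 0 = u i 0 - v i 0.
Proof. by rewrite !mxE. Qed.

Lemma colZ c (u : 'cV[R]_n) i : (c *: u) i 0 = c * u i 0.
Proof. by rewrite mxE. Qed.

Lemma sqnormB_le (u v : 'cV[R]_n) : sqnorm (u - v) <= 2 * sqnorm u + 2 * sqnorm v.
Proof.
rewrite !mulr_sumr -big_split/=; apply: ler_sum => i _; rewrite !mxE.
have := sqr_ge0 (u i 0 + v i 0); rewrite sqrrB sqrrD; lra.
Qed.

(** The bound on the norm [infinity_norm], without the maximum. *)
Definition rowsum_le (m : R) A := forall i, \sum_j `|A i j| <= m.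

Definition sqF A : R := \sum_i \sum_j A i j ^+ 2.

Lemma sqF_ge0 A : 0 <= sqF A.
Proof. by apply: sumr_ge0 => i _; apply: sumr_ge0 => j _; exact: sqr_ge0. Qed.

Lemma tr_sym A i j : A^T = A -> A i j = A j i.
Proof. by move=> sA; rewrite -{1}sA mxE. Qed.

Lemma abs_mul_sqnorm A v m : A^T = A -> rowsum_le m A ->
  \sum_i (\sum_j `|A i j| * `|v j 0|) ^+ 2 <= m ^+ 2 * sqnorm v.
Proof.
move=> sA rA; have -> : sqnorm v = \sum_j `|v j 0| ^+ 2.
  by apply: eq_bigr => j _; rewrite real_normK ?num_real.
apply: (schur_test (K := fun i j => `|A i j|)) => // j.
by under eq_bigr do rewrite (tr_sym _ _ sA).
Qed.

Lemma sqnorm_mulmx A v m : A^T = A -> rowsum_le m A ->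
  sqnorm (A *m v) <= m ^+ 2 * sqnorm v.
Proof.
move=> sA rA; apply: le_trans (abs_mul_sqnorm v sA rA).
apply: ler_sum => i _; rewrite -[leLHS]real_normK ?num_real//.
rewrite ler_sqr ?nnegrE//; last by apply: sumr_ge0 => j _; rewrite mulr_ge0.
rewrite mxE; apply: le_trans (ler_norm_sum _ _ _) _.
by apply: ler_sum => j _; rewrite normrM.
Qed.

Lemma row_sqr_le A i m : rowsum_le m A -> \sum_j A i j ^+ 2 <= m ^+ 2.
Proof.
move=> rA; under eq_bigr do rewrite -[_ ^+ 2]real_normK ?num_real//.
apply: le_trans (sum_sqr_le_sqr_sum _) _ => //.
rewrite ler_sqr ?nnegrE//; first by apply: sumr_ge0.
by apply: le_trans (rA i); apply: sumr_ge0.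
Qed.

Lemma rowsum_leB A B m : rowsum_le m A -> rowsum_le m B -> rowsum_le (2 * m) (A - B).
Proof.
move=> rA rB i; apply: le_trans (_ : \sum_j (`|A i j| + `|B i j|) <= _).
  by apply: ler_sum => j _; rewrite !mxE ler_normB.
by rewrite big_split/= mulrDl mul1r; apply: lerD.
Qed.

End vectors.

(** * Single flips and the score *)

Section flip.
Variables (R : realType) (n : nat).
Implicit Types (x : config n) (i j : 'I_n) (A J : 'M[R]_n).

Definition flip i x : config n := [ffun j => if j == i then ~~ x j else x j].

Lemma flipK i : involutive (flip i).
Proof. by move=> x; apply/ffunP => j; rewrite !ffunE; case: eqP; rewrite ?negbK. Qed.

Lemma spinE x i : spin R x i 0 = (-1) ^+ x i.
Proof. by rewrite mxE. Qed.

Lemma spin_sqr x i : spin R x i 0 ^+ 2 = 1.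
Proof. by rewrite spinE sqrr_sign. Qed.

Lemma spin_norm x i : `|spin R x i 0| = 1.
Proof. by rewrite spinE normr_sign. Qed.

Lemma spin_flip i x :
  spin R (flip i x) = spin R x - (2 * spin R x i 0) *: delta_mx i 0.
Proof.
apply/matrixP => j k; rewrite !mxE !ffunE ord1 eqxx andbT.
case: eqP => [->|_]; last by rewrite mulr0 subr0.
by rewrite signrN mulr1; ring.
Qed.

Lemma spin_flip_same i x : spin R (flip i x) i 0 = - spin R x i 0.
Proof. by rewrite !spinE ffunE eqxx signrN. Qed.

Lemma spin_flip_neq i j x : j != i -> spin R (flip i x) j 0 = spin R x j 0.
Proof. by move=> ji; rewrite !spinE ffunE (negPf ji). Qed.

Lemma mulmx_delta A i j : (A *m (delta_mx i 0 : 'cV_n)) j 0 = A j i.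
Proof.
rewrite mxE (bigD1 i)//= big1 => [|k ki]; rewrite mxE eqxx ?mulr1 ?addr0//.
by rewrite (negPf ki) mulr0.
Qed.

Lemma mulmx_spin_flip A i j x : (A *m spin R (flip i x)) j 0
  = (A *m spin R x) j 0 - 2 * spin R x i 0 * A j i.
Proof.
by rewrite spin_flip mulmxBr -scalemxAr mxE [X in _ + X]mxE [X in - X]mxE mulmx_delta.
Qed.

(** [score J x i] is half the derivative in the local field of the log-likelihood
    of spin [i] given all the others. *)
Definition score J x : 'cV[R]_n :=
  \col_i (spin R x i 0 * sigmoid (- (2 * spin R x i 0 * (J *m spin R x) i 0))).

Lemma scoreE J x i : score J x i 0 =
  spin R x i 0 * sigmoid (- (2 * spin R x i 0 * (J *m spin R x) i 0)).
Proof. by rewrite mxE. Qed.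

Lemma score_norm_le1 J x i : `|score J x i 0| <= 1.
Proof.
rewrite scoreE normrM spin_norm mul1r.
by rewrite (ger0_norm (ltW (sigmoid_gt0 _))) sigmoid_le1.
Qed.

Lemma spin_score J x i : spin R x i 0 * score J x i 0 =
  sigmoid (- (2 * spin R x i 0 * (J *m spin R x) i 0)).
Proof. by rewrite scoreE mulrA -expr2 spin_sqr mul1r. Qed.

Variable J : 'M[R]_n.
Hypotheses (symJ : J^T = J) (J0 : forall i, J i i = 0).

Lemma quadratic_formE x :
  ((spin R x)^T *m J *m spin R x) 0 0 = dot (spin R x) (J *m spin R x).
Proof. by rewrite -mulmxA mxE; apply: eq_bigr => i _; rewrite mxE. Qed.

Lemma ising_weight_gt0 x : 0 < ising_weight J x.
Proof. exact: expR_gt0. Qed.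

Lemma ising_weight_flip i x : ising_weight J (flip i x) =
  ising_weight J x * expR (- (2 * spin R x i 0 * (J *m spin R x) i 0)).
Proof.
rewrite /ising_weight -expRD !quadratic_formE; congr expR.
rewrite {1}spin_flip dotDl dotNl dotZl (dotC (delta_mx _ _)) dot_delta.
rewrite -(dot_mulmx (spin R x) _ symJ) mulmx_spin_flip J0 mulr0 subr0 spin_flip.
by rewrite dotDr dotNr dotZr dot_delta dotC; field.
Qed.

(** The score of spin [i] is centred given the other spins: the weights of [x]
    and of its flip at [i] balance exactly. *)
Lemma weight_score_flip i x : ising_weight J (flip i x) * score J (flip i x) i 0
  = - (ising_weight J x * score J x i 0).
Proof.
rewrite ising_weight_flip !scoreE spin_flip_same mulmx_spin_flip J0 mulr0 subr0.
set z := 2 * _ * _; have -> : 2 * - spin R x i 0 * (J *m spin R x) i 0 = - z.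
  by rewrite /z; ring.
rewrite /sigmoid !opprK expRN; have := expR_gt0 z; set e := expR z => e0.
by field; rewrite !lt0r_neq0//; lra.
Qed.

(** The two values of a spin have conditional probabilities that add up to 1, so
    flipping it changes its own score by exactly the spin. *)
Lemma score_flip_same i x :
  score J x i 0 - score J (flip i x) i 0 = spin R x i 0.
Proof.
rewrite !scoreE spin_flip_same mulmx_spin_flip J0 mulr0 subr0.
set z := 2 * _ * _; have -> : 2 * - spin R x i 0 * (J *m spin R x) i 0 = - z.
  by rewrite /z; ring.
by rewrite !sigmoidN; ring.
Qed.

Lemma score_flip_neq i j x : j != i ->
  `|score J x j 0 - score J (flip i x) j 0| <= 4 * `|J i j|.
Proof.
move=> ji; rewrite !scoreE spin_flip_neq// mulmx_spin_flip -mulrBr normrM spin_norm mul1r.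
apply: le_trans (sigmoid_lipschitz _ _) _.
rewrite (_ : _ - _ = - (4 * (spin R x j 0 * spin R x i 0 * J j i))); last by ring.
by rewrite normrN !normrM !spin_norm !mul1r (tr_sym _ _ symJ) ger0_norm.
Qed.

(** The indirect effect of the flip at [i], on the scores of the other spins. *)
Definition score_remainder i x : 'cV[R]_n :=
  score J x - score J (flip i x) - spin R x i 0 *: delta_mx i 0.

Lemma score_remainder_le i x j : `|score_remainder i x j 0| <= 4 * `|J i j|.
Proof.
rewrite !mxE eqxx andbT; have [->|ji] := eqVneq j i.
  by have := score_flip_same i x; rewrite !mxE mulr1 => ->; rewrite subrr normr0 mulr_ge0.
by have := score_flip_neq x ji; rewrite !mxE mulr0 subr0.
Qed.

Lemma score_flip i x : score J (flip i x) =
  score J x - spin R x i 0 *: delta_mx i 0 - score_remainder i x.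
Proof. by rewrite /score_remainder; apply/matrixP => j k; rewrite !mxE; ring. Qed.

End flip.

(** * Tilted expectations *)

Section tilt.
Variables (R : realType) (n : nat).
Variable mu : config n -> R.
Hypothesis mu_gt0 : forall x, 0 < mu x.

Definition expect (f : config n -> R) : R := (\sum_x mu x * f x) / \sum_x mu x.

Lemma mass_gt0 : 0 < \sum_x mu x.
Proof.
rewrite (bigD1 [ffun=> false])//=; apply: ltr_pwDl => //.
by apply: sumr_ge0 => x _; exact: ltW.
Qed.

Lemma eq_expect f g : f =1 g -> expect f = expect g.
Proof. by move=> fg; rewrite /expect; under eq_bigr do rewrite fg. Qed.

Lemma expectD f g : expect (fun x => f x + g x) = expect f + expect g.
Proof.
rewrite /expect -mulrDl -big_split/=; congr (_ / _).
by apply: eq_bigr => x _; rewrite mulrDr.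
Qed.

Lemma expectZ c f : expect (fun x => c * f x) = c * expect f.
Proof.
rewrite /expect mulrA mulr_sumr; congr (_ / _).
by apply: eq_bigr => x _; ring.
Qed.

Lemma expectN f : expect (fun x => - f x) = - expect f.
Proof. by rewrite -mulN1r -expectZ; apply: eq_expect => x; rewrite mulN1r. Qed.

Lemma expect_cst c : expect (fun=> c) = c.
Proof. by rewrite /expect -mulr_suml mulrAC mulfV ?mul1r// lt0r_neq0 ?mass_gt0. Qed.

Lemma le_expect f g : (forall x, f x <= g x) -> expect f <= expect g.
Proof.
move=> fg; rewrite /expect ler_pM2r ?invr_gt0 ?mass_gt0//.
by apply: ler_sum => x _; rewrite ler_pM2l.
Qed.

Lemma expect_sum (I : finType) (f : I -> config n -> R) :
  expect (fun x => \sum_i f i x) = \sum_i expect (f i).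
Proof.
rewrite /expect -mulr_suml exchange_big/=; congr (_ / _).
by apply: eq_bigr => x _; rewrite mulr_sumr.
Qed.

(** Jensen's inequality, from the tangent of the exponential at the mean. *)
Lemma expR_expect_le f : expR (expect f) <= expect (fun x => expR (f x)).
Proof.
set m := expect f.
rewrite -[leLHS](expect_cst) -[leLHS]addr0.
have -> : 0 = expR m * (expect f - m) by rewrite subrr mulr0.
rewrite -(expect_cst m) -expectN -expectD -expectZ -expectD.
apply: le_expect => x; rewrite expect_cst.
have := expR_ge1Dx (f x - m); rewrite -(ler_pM2l (expR_gt0 m)) -expRD.
by rewrite [m + _]addrC subrK mulrDr mulr1.
Qed.

End tilt.

Section tilted_ising.
Variables (R : realType) (n : nat) (J : 'M[R]_n).
Hypotheses (symJ : J^T = J) (J0 : forall i, J i i = 0).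
Variables (H : config n -> R) (lam : R).
Hypothesis lam_ge0 : 0 <= lam.

Definition tilted_weight x := ising_weight J x * expR (- (lam * H x)).

Lemma tilted_weight_gt0 x : 0 < tilted_weight x.
Proof. by rewrite mulr_gt0 ?expR_gt0 ?ising_weight_gt0. Qed.

Notation E := (expect tilted_weight).

Lemma reindex_flip i (f : config n -> R) : \sum_x f x = \sum_x f (flip i x).
Proof. by apply: reindex_inj; apply: inv_inj; exact: flipK. Qed.

(** Under the tilted law the score is no longer centred, but its bias is
    controlled by the variation of the tilt under single flips: averaging the sum
    with its image under the flip leaves the difference of the two tilts, the
    scores and the Ising weights having cancelled. *)
Lemma tilted_score_le i (u : config n -> R) :
  (forall x, u (flip i x) = u x) ->
  `|E (fun x => score J x i 0 * u x)|
    <= lam * E (fun x => `|H x - H (flip i x)| * `|u x|).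
Proof.
move=> fu; rewrite /expect normrM mulrA.
have mZ := mass_gt0 tilted_weight_gt0.
rewrite [`|_^-1|]gtr0_norm ?invr_gt0// ler_pM2r ?invr_gt0//.
set S := \sum_x _; set T := \sum_x _.
pose w := ising_weight J; pose g x := score J x i 0.
pose e x := expR (- (lam * H x)); pose D x := H x - H (flip i x).
have S2 : S + S = \sum_x w x * g x * u x * (e x - e (flip i x)).
  rewrite {2}/S (reindex_flip i) -big_split/=; apply: eq_bigr => x _.
  rewrite fu /tilted_weight -/w.
  have wf : w (flip i x) * g (flip i x) = - (w x * g x) := weight_score_flip symJ J0 i x.
  rewrite -/(g x) -/(g (flip i x)) -/(e x) -/(e (flip i x)).
  transitivity (w x * g x * e x * u x + w (flip i x) * g (flip i x) * e (flip i x) * u x).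
    by ring.
  by rewrite wf; ring.
have wg x : `|w (flip i x) * g (flip i x)| = `|w x * g x|.
  by rewrite /w /g weight_score_flip// normrN.
have T2 : \sum_x `|w x * g x| * `|u x| * `|D x| * (e x + e (flip i x))
   <= T + T.
  rewrite (_ : \sum_x _ = \sum_x `|w x * g x| * `|u x| * `|D x| * e x +
     \sum_x `|w x * g x| * `|u x| * `|D x| * e x); last first.
    rewrite [X in _ = _ + X](reindex_flip i) -big_split/=; apply: eq_bigr => x _.
    have Df : `|D (flip i x)| = `|D x| by rewrite /D flipK distrC.
    by rewrite (wg x) (fu x) Df mulrDr.
  have le1 : \sum_x `|w x * g x| * `|u x| * `|D x| * e x <= T.
    apply: ler_sum => x _; rewrite normrM (ger0_norm (ltW (ising_weight_gt0 _ _))).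
    rewrite /tilted_weight -/(w x) -/(e x).
    have : 0 <= w x * `|u x| * `|D x| * e x.
      by rewrite !mulr_ge0// ?expR_ge0// ltW// ising_weight_gt0.
    have := score_norm_le1 J x i; rewrite -/(g x) /D => gl h0.
    have := ler_wpM2r h0 gl; rewrite mul1r; lra.
  lra.
suff : `|S + S| <= lam * (T + T).
  have -> : S + S = 2 * S by ring.
  by rewrite normrM ger0_norm//; lra.
apply: le_trans (ler_wpM2l lam_ge0 T2); rewrite S2 mulr_sumr.
apply: le_trans (ler_norm_sum _ _ _) _; apply: ler_sum => x _.
rewrite normrM [`|w x * g x * u x|]normrM.
have -> : lam * (`|w x * g x| * `|u x| * `|D x| * (e x + e (flip i x))) =
  `|w x * g x| * `|u x| * (lam * `|D x| * (e x + e (flip i x))) by ring.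
apply: ler_wpM2l; first by rewrite mulr_ge0.
apply: le_trans (expR_sub_le _ _) _; rewrite ler_wpM2r ?addr_ge0 ?expR_ge0//.
have -> : - (lam * H x) - - (lam * H (flip i x)) = - (lam * D x) by rewrite /D; ring.
by rewrite normrN normrM (ger0_norm lam_ge0).
Qed.

Definition flip_gradient x : 'cV[R]_n := \col_i (H x - H (flip i x)).

Lemma tilted_score_dot_le (U : config n -> 'cV[R]_n) :
  (forall i x, U (flip i x) i 0 = U x i 0) ->
  `|E (fun x => dot (score J x) (U x))| <=
  lam / 2 * (E (fun x => sqnorm (U x)) + E (fun x => sqnorm (flip_gradient x))).
Proof.
move=> fU; rewrite expect_sum; apply: le_trans (ler_norm_sum _ _ _) _.
apply: le_trans (ler_sum _ (fun i _ => tilted_score_le (fU i))) _.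
rewrite -mulr_sumr -mulrA ler_wpM2l// -expectD -expect_sum -expectZ.
apply: le_expect => [|x]; first exact: tilted_weight_gt0.
rewrite -big_split mulr_sumr/=; apply: ler_sum => i _; rewrite !mxE.
set a := H x - _; set b := U x i 0.
have := sqr_ge0 (`|a| - `|b|); rewrite sqrrB !real_normK ?num_real//; lra.
Qed.

End tilted_ising.

(** * The tilted mean of the excess loss *)

(** The inequalities between the tilted moments close on themselves once the
    tilt, hence [L], is small.  In the notation of the introduction [x], [y], [d]
    and [e] are the tilted means of [|A x|^2], [|A g|^2], [<A g, A x>] and
    [<g, A x>]; the last hypothesis is the completed square, with [s] chosen as
    [1 / (6 t ^ 3)] to balance [2 s d] against [s ^ 2 y]. *)
Lemma moment_bootstrap (R : realFieldType) (t k L F x y d e : R) :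
  1 <= t -> 0 < k -> k <= 1 -> L * (768 * t ^+ 6) = k ->
  0 <= F -> 0 <= x -> 0 <= y ->
  `|e| <= L * (x + y + F) ->
  F / (2 * t ^+ 2) - L * (x + y + F) <= d ->
  y <= 3 * t * F + L * (x + y + F) ->
  2 * (6 * t ^+ 3)^-1 * d - ((6 * t ^+ 3)^-1) ^+ 2 * y <= x ->
  k / (8 * t ^+ 5) * F <= - 2 * e + 4 * k * x.
Proof.
move=> t1 k0 k1 eL F0 x0 y0 he hd hy hx.
have t0 : 0 < t by lra.
have tn0 : t != 0 by rewrite lt0r_neq0.
have -> : k / (8 * t ^+ 5) * F = k * (F / t ^+ 5) / 8 by field.
have D0 : 0 < 768 * t ^+ 6 :> R by apply: mulr_gt0; [exact: ltr0n | exact: exprn_gt0].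
have LE : L = k / (768 * t ^+ 6) by rewrite -eL mulfK ?(lt0r_neq0 D0).
pose P := F / t ^+ 5; rewrite -/P.
have P0 : 0 <= P by rewrite divr_ge0// exprn_ge0// ltW.
set s := (6 * t ^+ 3)^-1 in hx.
have s0 : 0 < s by rewrite invr_gt0 mulr_gt0// exprn_gt0.
have s6 : s <= 6^-1.
  have D3 : 0 < 6 * t ^+ 3 :> R by apply: mulr_gt0; [exact: ltr0n | exact: exprn_gt0].
  by rewrite /s lef_pV2 ?posrE ?D3 ?ltr0n// ler_peMr ?ler0n// exprn_ege1.
have L0 : 0 <= L by rewrite LE; apply: divr_ge0; apply: ltW.
have LtF : L * (t * F) = k * P / 768 by rewrite LE /P; field.
have Lk : L <= k / 768.
  rewrite LE; apply: ler_wpM2l (ltW k0) _ _ _; rewrite lef_pV2 ?posrE ?D0 ?ltr0n//.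
  by rewrite ler_peMr ?ler0n// exprn_ege1.
set Q := L * (x + y + F) in he hd hy.
have Q0 : 0 <= Q by rewrite /Q mulr_ge0// !addr_ge0.
have e1 : 2 * s * (F / (2 * t ^+ 2)) = P / 6 by rewrite /s /P; field.
have e2 : s ^+ 2 * (3 * t * F) = P / 12 by rewrite /s /P; field.
have s00 := ltW s0.
have hd' := ler_wpM2l s00 hd.
have hy' := ler_wpM2l (exprn_ge0 2 s00) hy.
have sQ : s * Q <= 6^-1 * Q by rewrite ler_wpM2r.
have ssQ : s ^+ 2 * Q <= 6^-1 * Q.
  by apply: le_trans sQ; rewrite ler_wpM2r// expr2 ler_piMl//; lra.
have xP : P / 12 - Q <= x by lra.
have QE : Q <= L * x + 4 * (L * (t * F)) + L * Q.
  have : L * (y + F) <= L * (4 * (t * F) + Q).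
    have tF : F <= t * F by rewrite ler_peMl.
    by apply: ler_wpM2l => //; lra.
  by rewrite /Q; lra.
have Lx : L * x <= k / 768 * x by rewrite ler_wpM2r.
have LQ : L * Q <= 768^-1 * Q by rewrite ler_wpM2r//; lra.
have kP := ler_wpM2l (ltW k0) xP.
have kQ : k * Q <= Q by rewrite ler_piMl.
have kP0 : 0 <= k * P by rewrite mulr_ge0 ?(ltW k0).
move: he; rewrite ler_norml => /andP[_ he].
rewrite LtF in QE.
lra.
Qed.

Section perturbation.
Variables (R : realType) (n : nat) (J A : 'M[R]_n) (M : R).
Hypotheses (symJ : J^T = J) (J0 : forall i, J i i = 0) (rowJ : rowsum_le M J).
Hypotheses (symA : A^T = A) (A0 : forall i, A i i = 0) (rowA : rowsum_le (2 * M) A).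
Hypothesis M_gt0 : 0 < M.

Local Notation t := (expR M).
Local Notation F := (sqF A).
Local Notation g := (score J).

Definition row_sqnorm i : R := \sum_j A i j ^+ 2.
Definition spin_image x : 'cV[R]_n := A *m spin R x.
Definition score_image x : 'cV[R]_n := A *m g x.

Local Notation N := row_sqnorm.
Local Notation b := spin_image.
Local Notation a := score_image.

Lemma expR_ge1 : 1 <= t. Proof. by have := M_gt0; have := expR_ge1Dx M; lra. Qed.
Lemma le_expR : M <= t. Proof. by have := M_gt0; have := expR_ge1Dx M; lra. Qed.

Lemma rowJ_t : rowsum_le t J.
Proof. by move=> i; apply: le_trans (rowJ i) le_expR. Qed.

Lemma rowA_t : rowsum_le (2 * t) A.
Proof. by move=> i; apply: le_trans (rowA i) _; rewrite ler_pM2l// le_expR. Qed.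

Lemma row_sqnorm_ge0 i : 0 <= N i.
Proof. by apply: sumr_ge0 => j _; exact: sqr_ge0. Qed.

Lemma row_sqnorm_le i : N i <= 4 * t ^+ 2.
Proof. by apply: le_trans (row_sqr_le i rowA_t) _; rewrite exprMn; lra. Qed.

Lemma local_field_le i x : `|(J *m spin R x) i 0| <= M.
Proof.
rewrite mxE; apply: le_trans (ler_norm_sum _ _ _) _.
by apply: le_trans (rowJ i); apply: ler_sum => j _; rewrite normrM spin_norm mulr1.
Qed.

Lemma expR_field_le i x (s : R) : `|s| = 1 ->
  expR (2 * s * (J *m spin R x) i 0) <= t ^+ 2.
Proof.
move=> s1; rewrite -expRM_natl ler_expR; apply: le_trans (ler_norm _) _.
by rewrite !normrM s1 mulr1 ger0_norm// ler_pM2l// local_field_le.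
Qed.

Lemma spin_score_ge i x : (2 * t ^+ 2)^-1 <= spin R x i 0 * g x i 0.
Proof.
have t1 := expR_ge1; have tt : 1 <= t ^+ 2 by rewrite exprn_ege1.
rewrite spin_score sigmoidV lef_pV2 ?posrE ?expR1_gt0//; last by lra.
by have := expR_field_le i x (spin_norm R x i); lra.
Qed.

Lemma mul_sym_le i j : `|(A *m A) i j| <= (N i + N j) / 2.
Proof.
rewrite mxE; apply: le_trans (ler_norm_sum _ _ _) _.
rewrite -big_split mulr_suml; apply: ler_sum => k _ /=.
rewrite normrM (tr_sym k j symA).
have := sqr_ge0 (`|A i k| - `|A j k|); rewrite sqrrB !real_normK ?num_real//; lra.
Qed.

Lemma mul_sym_diag i : (A *m A) i i = N i.
Proof.
rewrite mxE; apply: eq_bigr => k _.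
by rewrite (tr_sym k i symA) expr2.
Qed.

Lemma spin_image_flip i x :
  b (flip i x) = b x - (2 * spin R x i 0) *: (A *m delta_mx i 0).
Proof. by rewrite /b spin_flip mulmxBr -scalemxAr. Qed.

Lemma spin_image_flip_same i x : b (flip i x) i 0 = b x i 0.
Proof. by rewrite /b mulmx_spin_flip A0 mulr0 subr0. Qed.

Lemma dot_col u i : dot u (A *m delta_mx i 0) = (A *m u) i 0.
Proof. by rewrite -dot_mulmx// dot_delta. Qed.

Lemma sqnorm_col i : sqnorm (A *m (delta_mx i 0 : 'cV_n)) = N i.
Proof.
by apply: eq_bigr => j _; rewrite mulmx_delta (tr_sym _ _ symA).
Qed.

Local Notation r := (score_remainder J).

Lemma dot_remainder_le i x (v : 'cV[R]_n) :
  `|dot (r i x) v| <= 4 * \sum_j `|J i j| * `|v j 0|.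
Proof.
apply: le_trans (ler_norm_sum _ _ _) _; rewrite mulr_sumr; apply: ler_sum => j _.
by rewrite normrM mulrA ler_wpM2r// score_remainder_le.
Qed.

(** The direct effect of the flip involves [A i i], which vanishes; what remains is
    linear in the two images of [A], up to the indirect effect on the scores. *)
Lemma dot_flip i x : dot (g x) (b x) - dot (g (flip i x)) (b (flip i x)) =
  spin R x i 0 * (b x i 0 + 2 * a x i 0)
  + (dot (r i x) (b x) - 2 * spin R x i 0 * (A *m r i x) i 0).
Proof.
rewrite spin_image_flip (score_flip J i x); move: (r i x) => v.
rewrite !(dotDl, dotNl, dotZl, dotDr, dotNr, dotZr) !dot_col (dotC (delta_mx _ _)) dot_delta mulmx_delta A0 /a.
by ring.
Qed.

Lemma sqnorm_flip i x : sqnorm (b x) - sqnorm (b (flip i x)) =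
  4 * (spin R x i 0 * (A *m b x) i 0 - N i).
Proof.
rewrite spin_image_flip !sqnormE !(dotDl, dotNl, dotZl, dotDr, dotNr, dotZr).
rewrite !(dotC _ (b x)) !dot_col -(sqnorm_col i) sqnormE dot_col.
set s := spin R x i 0; set p := (A *m b x) i 0; set q := (A *m _) i 0.
have ss : s * s = 1 by rewrite -expr2 spin_sqr.
transitivity (4 * (s * p) - 4 * (s * s) * q); first by ring.
by rewrite ss; ring.
Qed.

Variable k : R.
Hypotheses (k0 : 0 < k) (k1 : k <= 1).

(** For [k] the constant of [softplus_strongly_convex], the quadratic minorant of the
    increase of the loss from [J] to [J + A]. *)
Definition excess x : R := - 2 * dot (g x) (b x) + 4 * k * sqnorm (b x).

Local Notation XX x := (sqnorm (b x)).
Local Notation YY x := (sqnorm (a x)).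

Lemma sum_row_prod_le : \sum_i (\sum_j `|J i j| * `|A i j|) ^+ 2 <= t ^+ 2 * F.
Proof.
rewrite mulr_sumr; apply: ler_sum => i _.
apply: le_trans (cauchy_schwarz_sum _ _) _.
under eq_bigr do rewrite real_normK ?num_real//.
under [X in _ * X <= _]eq_bigr do rewrite real_normK ?num_real//.
by apply: ler_wpM2r (row_sqr_le i rowJ_t); exact: row_sqnorm_ge0.
Qed.

Lemma sum_row_sqnorm_sqr_le : \sum_i N i ^+ 2 <= 4 * t ^+ 2 * F.
Proof.
rewrite mulr_sumr; apply: ler_sum => i _.
by rewrite expr2 ler_wpM2r ?row_sqnorm_ge0// row_sqnorm_le.
Qed.

(** Everything that a flip changes in [excess] is linear in [b x] and in [a x],
    through matrices with bounded row sums, apart from constants whose squares sum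
    to a multiple of [F].  This makes the tilted bias a lower order term. *)
Lemma flip_gradient_le x : sqnorm (flip_gradient excess x) <=
  100 ^+ 2 * t ^+ 2 * (XX x + YY x + F).
Proof.
pose P i := \sum_j `|J i j| * `|b x j 0|.
pose Q i := \sum_j `|J i j| * `|A i j|.
pose B := A *m b x.
have le6 i : (flip_gradient excess x i 0) ^+ 2 <=
    6 * ((2 * b x i 0) ^+ 2 + (4 * a x i 0) ^+ 2 + (8 * P i) ^+ 2
     + (16 * Q i) ^+ 2 + (16 * B i 0) ^+ 2 + (16 * N i) ^+ 2).
  have -> : (2 * b x i 0) ^+ 2 = (2 * `|b x i 0|) ^+ 2.
    by rewrite !exprMn real_normK ?num_real.
  have -> : (4 * a x i 0) ^+ 2 = (4 * `|a x i 0|) ^+ 2.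
    by rewrite !exprMn real_normK ?num_real.
  have -> : (16 * B i 0) ^+ 2 = (16 * `|B i 0|) ^+ 2.
    by rewrite !exprMn real_normK ?num_real.
  apply: le_trans (sqr_sum6_le _ _ _ _ _ _).
  have P0 : 0 <= P i by apply: sumr_ge0 => j _; rewrite mulr_ge0.
  have Q0 : 0 <= Q i by apply: sumr_ge0 => j _; rewrite mulr_ge0.
  have N0 := row_sqnorm_ge0 i.
  rewrite -[leLHS]real_normK ?num_real// ler_sqr ?nnegrE ?addr_ge0 ?mulr_ge0//.
  have -> : flip_gradient excess x i 0 =
     - 2 * (dot (g x) (b x) - dot (g (flip i x)) (b (flip i x)))
     + 4 * k * (XX x - XX (flip i x)) by rewrite mxE /excess; ring.
  rewrite dot_flip sqnorm_flip -/B.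
  have h1 : `|dot (r i x) (b x)| <= 4 * P i by exact: dot_remainder_le.
  have h2 : `|(A *m r i x) i 0| <= 4 * Q i.
    rewrite -dot_col; apply: le_trans (dot_remainder_le _ _ _) _.
    rewrite ler_pM2l// /Q; apply: ler_sum => j _.
    by rewrite mulmx_delta (tr_sym _ _ symA).
  move: h1 h2; set p := dot _ _; set q := (A *m r i x) i 0.
  set s := spin R x i 0; have s1 : `|s| = 1 by rewrite spin_norm.
  move=> h1 h2.
  have kB : k * `|B i 0| <= `|B i 0| by rewrite ler_piMl.
  have kN : k * N i <= N i by rewrite ler_piMl.
  have -> : - 2 * (s * (b x i 0 + 2 * a x i 0) + (p - 2 * s * q)) +
    4 * k * (4 * (s * B i 0 - N i)) =
    - 2 * (s * b x i 0) + - 4 * (s * a x i 0) + (- 2 * p) + 4 * (s * q)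
    + 16 * (s * (k * B i 0)) + - 16 * (k * N i) by ring.
  have tri (c d c' d' : R) : `|c| <= c' -> `|d| <= d' -> `|c + d| <= c' + d'.
    by move=> hc hd; apply: le_trans (ler_normD _ _) _; exact: lerD.
  apply: (tri); [apply: (tri); [apply: (tri); [apply: (tri); [apply: (tri)|]|]|]|].
  - by rewrite !normrM s1 mul1r normrN normr_nat.
  - by rewrite !normrM s1 mul1r normrN normr_nat.
  - by rewrite normrM normrN normr_nat; lra.
  - by rewrite !normrM s1 mul1r normr_nat; lra.
  - by rewrite !normrM s1 mul1r normr_nat (ger0_norm (ltW k0)); lra.
  - rewrite normrM normrN normr_nat ger0_norm; first by lra.
    by rewrite mulr_ge0// ltW.
have t1 := expR_ge1; have tt : 1 <= t ^+ 2 by rewrite exprn_ege1.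
apply: le_trans (ler_sum _ (fun i _ => le6 i)) _.
rewrite -mulr_sumr !big_split/=.
under eq_bigr do rewrite exprMn.
under [X in 6 * (_ + X + _ + _ + _ + _)]eq_bigr do rewrite exprMn.
under [X in 6 * (_ + X + _ + _ + _)]eq_bigr do rewrite exprMn.
under [X in 6 * (_ + X + _ + _)]eq_bigr do rewrite exprMn.
under [X in 6 * (_ + X + _)]eq_bigr do rewrite exprMn.
under [X in 6 * (_ + X)]eq_bigr do rewrite exprMn.
rewrite -!mulr_sumr.
have hP : \sum_i P i ^+ 2 <= t ^+ 2 * XX x by exact: abs_mul_sqnorm symJ rowJ_t.
have hQ : \sum_i Q i ^+ 2 <= t ^+ 2 * F by exact: sum_row_prod_le.
have hB : \sum_i B i 0 ^+ 2 <= (2 * t) ^+ 2 * XX x by exact: sqnorm_mulmx symA rowA_t.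
rewrite exprMn in hB.
have hN := sum_row_sqnorm_sqr_le.
rewrite -/(sqnorm (b x)) -/(sqnorm (a x)).
have X0 := sqnorm_ge0 (b x); have Y0 := sqnorm_ge0 (a x); have F0 := sqF_ge0 A.
have hX : XX x <= t ^+ 2 * XX x by rewrite ler_peMl.
have hY : YY x <= t ^+ 2 * YY x by rewrite ler_peMl.
have : 0 <= t ^+ 2 * F by rewrite mulr_ge0// ltW// exprn_gt0// expR_gt0.
(* Up to the factor [t ^ 2], the squares of [b x] and [a x] and [F] occur with
   coefficients that add up to 6552, 96 and 7680. *)
lra.
Qed.

Variable lam : R.
Hypothesis lam_ge0 : 0 <= lam.

Local Notation E := (expect (tilted_weight J excess lam)).
Local Notation EX := (E (fun x => XX x)).
Local Notation EY := (E (fun x => YY x)).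
Local Notation S := (EX + EY + F).
Local Notation L := (lam * 100 ^+ 2 * t ^+ 4).

Let w_gt0 := tilted_weight_gt0 J excess lam.

Lemma expect_ge0 f : (forall x, 0 <= f x) -> 0 <= E f.
Proof. by move=> f0; rewrite -[0](expect_cst w_gt0); apply: le_expect. Qed.

Lemma expect_flip_gradient_le :
  E (fun x => sqnorm (flip_gradient excess x)) <= 100 ^+ 2 * t ^+ 2 * S.
Proof.
rewrite -[F](expect_cst w_gt0) -!expectD -expectZ; apply: le_expect => // x.
exact: flip_gradient_le.
Qed.

(** Both terms of [tilted_score_dot_le] are multiples of [S], the sum of the tilted
    second moments, so that a single small factor [L] serves for all the biases. *)
Lemma score_dot_bias (U : config n -> 'cV[R]_n) (c : R) :
  (forall i x, U (flip i x) i 0 = U x i 0) -> 0 <= c -> c <= 100 ^+ 2 * t ^+ 4 ->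
  E (fun x => sqnorm (U x)) <= c * S ->
  `|E (fun x => dot (g x) (U x))| <= L * S.
Proof.
move=> fU c0 c1 hU.
apply: le_trans (tilted_score_dot_le symJ J0 _ lam_ge0 fU) _.
have X0 : 0 <= EX by apply: expect_ge0 => x; exact: sqnorm_ge0.
have Y0 : 0 <= EY by apply: expect_ge0 => x; exact: sqnorm_ge0.
have S0 : 0 <= S by rewrite !addr_ge0 ?sqF_ge0.
have t1 := expR_ge1; have tt : 1 <= t ^+ 2 by rewrite exprn_ege1.
rewrite -!mulrA; apply: ler_wpM2l => //; rewrite mulrC ler_pdivrMr//.
have := expect_flip_gradient_le.
have h1 : c * S <= 100 ^+ 2 * t ^+ 4 * S by rewrite ler_wpM2r.
have h2 : t ^+ 2 * S <= t ^+ 4 * S.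
  by rewrite ler_wpM2r// [t ^+ 4](_ : _ = t ^+ 2 * t ^+ 2) ?ler_peMl//; ring.
have : 0 <= t ^+ 4 * S by rewrite mulr_ge0 ?exprn_ge0 ?expR_ge0.
by lra.
Qed.

Lemma expect_score_spin_le : `|E (fun x => dot (g x) (b x))| <= L * S.
Proof.
have t1 := expR_ge1; have tt : 1 <= t ^+ 4 by rewrite exprn_ege1.
apply: (@score_dot_bias _ 1) => //; [exact: spin_image_flip_same | by lra |].
rewrite mul1r -addrA lerDl addr_ge0 ?sqF_ge0//.
by apply: expect_ge0 => x; exact: sqnorm_ge0.
Qed.

(** The [i]-th coordinate of [A *m b x] depends on spin [i] only through the diagonal
    term [N i] of the square of [A]; the contribution of this term has a sign, as
    the product of a spin and its score is bounded below. *)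
Lemma expect_images_ge :
  F / (2 * t ^+ 2) - L * S <= E (fun x => dot (a x) (b x)).
Proof.
have t1 := expR_ge1; have tt : 1 <= t ^+ 2 by rewrite exprn_ege1.
pose V x : 'cV[R]_n := \col_i (N i * spin R x i 0).
pose U x := A *m b x - V x.
have VE y i : V y i 0 = N i * spin R y i 0 by rewrite mxE.
have fU i x : U (flip i x) i 0 = U x i 0.
  rewrite /U /b !mulmxA !colB !VE mulmx_spin_flip mul_sym_diag spin_flip_same.
  by ring.
have VF x : sqnorm (V x) <= 4 * t ^+ 2 * F.
  apply: le_trans sum_row_sqnorm_sqr_le; apply: ler_sum => i _.
  by rewrite mxE exprMn spin_sqr mulr1.
have Y0 : 0 <= EY by apply: expect_ge0 => x; exact: sqnorm_ge0.
have hU : E (fun x => sqnorm (U x)) <= 8 * t ^+ 2 * S.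
  apply: le_trans (_ : 8 * t ^+ 2 * (EX + F) <= _).
    rewrite -[F](expect_cst w_gt0) -expectD -expectZ; apply: le_expect => // x.
    apply: le_trans (sqnormB_le _ _) _.
    have := sqnorm_mulmx (b x) symA rowA_t; rewrite exprMn.
    by have := VF x; lra.
  by apply: ler_wpM2l; [rewrite mulr_ge0 ?exprn_ge0 ?expR_ge0 | lra].
have t24 : t ^+ 2 <= t ^+ 4 by exact: ler_weXn2l.
have := score_dot_bias fU _ _ hU; rewrite mulr_ge0 ?exprn_ge0 ?expR_ge0// => /(_ isT).
have -> : 8 * t ^+ 2 <= 100 ^+ 2 * t ^+ 4 by lra.
move=> /(_ isT); rewrite ler_norml => /andP[h _].
apply: le_trans (_ : E (fun x => dot (g x) (U x)) + F / (2 * t ^+ 2) <= _).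
  by lra.
rewrite -[F / _](expect_cst w_gt0) -expectD; apply: le_expect => // x.
have -> : dot (a x) (b x) = dot (g x) (U x) + dot (g x) (V x).
  by rewrite -dotDr /U subrK /a dot_mulmx.
rewrite lerD2l.
rewrite /sqF mulr_suml; apply: ler_sum => i _; rewrite VE.
have -> : g x i 0 * (N i * spin R x i 0) = N i * (spin R x i 0 * g x i 0) by ring.
by apply: ler_wpM2l; [exact: row_sqnorm_ge0 | exact: spin_score_ge].
Qed.

(** Here the [i]-th factor [(A *m a x) i 0] depends on spin [i] in a nonlinear way, so
    it is symmetrized under the flip: [U] is the symmetric part and [V] the
    antisymmetric part.  The latter is at most [c i], whose sum is of order [F]. *)
Lemma expect_score_image_le : EY <= 3 * t * F + L * S.
Proof.
have t1 := expR_ge1; have tt : 1 <= t ^+ 2 by rewrite exprn_ege1.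
have t24 : t ^+ 2 <= t ^+ 4 by exact: ler_weXn2l.
have X0 : 0 <= EX by apply: expect_ge0 => x; exact: sqnorm_ge0.
have Y0 : 0 <= EY by apply: expect_ge0 => x; exact: sqnorm_ge0.
have F0 := sqF_ge0 A.
have [V VE] : exists V : config n -> 'cV[R]_n, forall x i,
    V x i 0 = ((A *m a x) i 0 - (A *m a (flip i x)) i 0) / 2.
  exists (fun x => \col_i (((A *m a x) i 0 - (A *m a (flip i x)) i 0) / 2)) => x i.
  by rewrite mxE.
have [U UE] : exists U : config n -> 'cV[R]_n, forall x, U x = A *m a x - V x.
  by exists (fun x => A *m a x - V x).
have fU i x : U (flip i x) i 0 = U x i 0.
  rewrite (UE (flip i x)) (UE x) !colB (VE (flip i x)) (VE x) flipK.
  exact: half_difference_swap.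
pose c i := N i / 2 + t * N i + \sum_j `|J i j| * N j.
have Vc x i : `|V x i 0| <= c i.
  rewrite VE normrM normfV normr_nat ler_pdivrMr//.
  rewrite (_ : _ - _ = spin R x i 0 * N i + (A *m A *m score_remainder J i x) i 0);
    last first.
    rewrite -mul_sym_diag -mulmx_delta /a (score_flip J i x).
    move: (score_remainder _ _ _) (g x) => v w.
    by rewrite !mulmxA !mulmxBr -!scalemxAr !colB colZ; ring.
  apply: le_trans (ler_normD _ _) _; rewrite normrM spin_norm mul1r ger0_norm ?row_sqnorm_ge0//.
  have : `|(A *m A *m score_remainder J i x) i 0| <=
      \sum_j (2 * (`|J i j| * N i) + 2 * (`|J i j| * N j)).
    rewrite mxE; apply: le_trans (ler_norm_sum _ _ _) _; apply: ler_sum => j _.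
    rewrite normrM; apply: le_trans (ler_pM _ _ (mul_sym_le i j)
      (score_remainder_le symJ J0 i x j)) _ => //.
    by lra.
  rewrite big_split -!mulr_sumr -mulr_suml/= => h.
  have := ler_wpM2r (row_sqnorm_ge0 i) (rowJ_t i).
  by rewrite /c; lra.
have cF : \sum_i c i <= 3 * t * F.
  rewrite /c !big_split/= -mulr_suml -mulr_sumr [X in _ + X <= _]exchange_big/=.
  have : \sum_j \sum_i `|J i j| * N j <= t * F.
    rewrite mulr_sumr; apply: ler_sum => j _; rewrite -mulr_suml.
    rewrite ler_wpM2r ?row_sqnorm_ge0//; apply: le_trans (rowJ_t j).
    by apply: ler_sum => i _; rewrite (tr_sym _ _ symJ).
  rewrite -/F; have : F <= t * F by rewrite ler_peMl.
  by lra.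
(* The squares are summed by bounding one of the two factors uniformly. *)
have c_ge0 i : 0 <= c i.
  by apply: le_trans (Vc [ffun=> false] i).
have c_le i : c i <= 10 * t ^+ 3.
  have hs : \sum_j `|J i j| * N j <= t * (4 * t ^+ 2).
    apply: le_trans (_ : \sum_j `|J i j| * (4 * t ^+ 2) <= _).
      by apply: ler_sum => j _; rewrite ler_wpM2l// row_sqnorm_le.
    by rewrite -mulr_suml ler_wpM2r ?rowJ_t.
  have hN := row_sqnorm_le i.
  have := ler_wpM2l (expR_ge0 M) hN; have t23 : t ^+ 2 <= t ^+ 3 by exact: ler_weXn2l.
  rewrite /c; have e : t * (4 * t ^+ 2) = 4 * t ^+ 3 by ring.
  by rewrite e in hs *; lra.
have VF x : sqnorm (V x) <= 30 * t ^+ 4 * F.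
  apply: le_trans (_ : \sum_i 10 * t ^+ 3 * c i <= _).
    apply: ler_sum => i _; rewrite -[leLHS]real_normK ?num_real// expr2.
    by apply: ler_pM => //; apply: le_trans (c_le i).
  rewrite -mulr_sumr; have := ler_wpM2l _ cF => /(_ (10 * t ^+ 3)).
  rewrite mulr_ge0 ?exprn_ge0 ?expR_ge0// => /(_ isT) h; apply: le_trans h _.
  by rewrite le_eqVlt; apply/orP; left; apply/eqP; ring.
have hU : E (fun x => sqnorm (U x)) <= 60 * t ^+ 4 * S.
  apply: le_trans (_ : 60 * t ^+ 4 * (EY + F) <= _).
    rewrite -[F](expect_cst w_gt0) -expectD -expectZ; apply: le_expect => // x.
    rewrite UE; apply: le_trans (sqnormB_le _ _) _.
    have := sqnorm_mulmx (a x) symA rowA_t; rewrite exprMn.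
    have := VF x; have := ler_wpM2r (sqnorm_ge0 (a x)) t24.
    have := mulr_ge0 (exprn_ge0 4 (expR_ge0 M)) (sqnorm_ge0 (a x)); lra.
  by apply: ler_wpM2l; [rewrite mulr_ge0 ?exprn_ge0 ?expR_ge0 | lra].
have := score_dot_bias fU _ _ hU; rewrite mulr_ge0 ?exprn_ge0 ?expR_ge0// => /(_ isT).
have -> : 60 * t ^+ 4 <= 100 ^+ 2 * t ^+ 4 by rewrite ler_wpM2r ?exprn_ge0 ?expR_ge0//; lra.
move=> /(_ isT); rewrite ler_norml => /andP[_ h].
apply: le_trans (_ : 3 * t * F + E (fun x => dot (g x) (U x)) <= _); last by rewrite lerD2l.
rewrite -[X in _ <= X + _](expect_cst w_gt0) -expectD; apply: le_expect => // x.
have -> : YY x = dot (g x) (V x) + dot (g x) (U x).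
  by rewrite -dotDr addrC UE subrK sqnormE {1}/a dot_mulmx.
rewrite lerD2r.
apply: le_trans cF; apply: le_trans (ler_norm _) _.
apply: le_trans (ler_norm_sum _ _ _) _; apply: ler_sum => i _.
rewrite normrM -[leRHS]mul1r; apply: ler_pM => //; exact: score_norm_le1.
Qed.

Lemma expect_excess_ge : L * (768 * t ^+ 6) = k ->
  k / (8 * t ^+ 5) * F <= E excess.
Proof.
move=> eL; have t1 := expR_ge1.
have t2 : 0 < t ^+ 2 by rewrite exprn_gt0// expR_gt0.
have -> : E excess = - 2 * E (fun x => dot (g x) (b x)) + 4 * k * EX.
  by rewrite -!expectZ -expectD.
apply: (@moment_bootstrap _ t k L F EX EY (E (fun x => dot (a x) (b x)))) => //.
- exact: sqF_ge0.
- by apply: expect_ge0 => x; exact: sqnorm_ge0.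
- by apply: expect_ge0 => x; exact: sqnorm_ge0.
- exact: expect_score_spin_le.
- exact: expect_images_ge.
- exact: expect_score_image_le.
- set s := (6 * t ^+ 3)^-1.
  rewrite -!expectZ -expectN -expectD; apply: le_expect => // x.
  rewrite /dot /sqnorm mulr_sumr mulr_sumr -sumrN -big_split/=.
  apply: ler_sum => i _.
  have := sqr_ge0 (b x i 0 - s * a x i 0); rewrite sqrrB exprMn; lra.
Qed.

(** Tilting turns the lower bound on the tilted mean into an exponential moment
    bound for the original law, by Jensen's inequality. *)
Lemma exponential_moment_excess : L * (768 * t ^+ 6) = k ->
  expect (ising_weight J) (fun x => expR (- (lam * excess x)))
  <= expR (- (lam * (k / (8 * t ^+ 5) * F))).
Proof.
move=> eL; have := ler_wpM2l lam_ge0 (expect_excess_ge eL).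
have e1 := expR_expect_le w_gt0 (fun x => lam * excess x).
rewrite -expectZ => e2.
have {e1 e2} h : expR (lam * (k / (8 * t ^+ 5) * F)) <= E (fun x => expR (lam * excess x)).
  by apply: le_trans e1; rewrite ler_expR.
rewrite expRN -[leLHS]invrK lef_pV2 ?posrE ?expR_gt0//; last first.
  rewrite invr_gt0 /expect divr_gt0 ?(mass_gt0 (ising_weight_gt0 J))//.
  exact: mass_gt0 w_gt0.
apply: le_trans h _; rewrite /expect invf_div.
rewrite le_eqVlt; apply/orP; left; apply/eqP; congr (_ / _).
by apply: eq_bigr => x _; rewrite /tilted_weight -mulrA [expR (- _) * _]mulrC expRxMexpNx_1 mulr1.
Qed.

End perturbation.

(** * Norms and covers *)

Section norm_facts.
Variables (R : realType) (n : nat).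
Implicit Types (A B : 'M[R]_n) (v : 'cV[R]_n).

Lemma l2normE v : l2norm v = Num.sqrt (sqnorm v).
Proof. by []. Qed.

Lemma frobenius_normE A : frobenius_norm A = Num.sqrt (sqF A).
Proof. by []. Qed.

Lemma frobenius_norm_ge0 A : 0 <= frobenius_norm A.
Proof. exact: sqrtr_ge0. Qed.

Lemma frobenius_norm_sqr A : frobenius_norm A ^+ 2 = sqF A.
Proof. by rewrite sqr_sqrtr// sqF_ge0. Qed.

Lemma l2norm_ge0 v : 0 <= l2norm v.
Proof. exact: sqrtr_ge0. Qed.

Lemma l2norm_sqr v : l2norm v ^+ 2 = sqnorm v.
Proof. by rewrite sqr_sqrtr// sqnorm_ge0. Qed.

Lemma l2normZ c v : l2norm (c *: v) = `|c| * l2norm v.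
Proof.
rewrite !l2normE (_ : sqnorm _ = c ^+ 2 * sqnorm v) ?(sqrtrM _ (sqr_ge0 c)) ?sqrtr_sqr//.
by rewrite mulr_sumr; apply: eq_bigr => i _; rewrite mxE exprMn.
Qed.

Lemma l2norm_mulmx_frobenius A v : l2norm (A *m v) <= frobenius_norm A * l2norm v.
Proof.
rewrite -ler_sqr ?nnegrE ?mulr_ge0 ?sqrtr_ge0// exprMn frobenius_norm_sqr !l2norm_sqr.
rewrite mulr_suml; apply: ler_sum => i _; rewrite mxE.
exact: cauchy_schwarz_sum.
Qed.

Lemma spectral_norm_has_sup A :
  has_sup [set l2norm (A *m v) | v in [set v : 'cV[R]_n | l2norm v <= 1]].
Proof.
split.
  exists (l2norm (A *m 0)), 0 => //=.
  by rewrite l2normE /sqnorm big1 ?sqrtr0// => i _; rewrite mxE expr0n.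
exists (frobenius_norm A) => _ [v /= v1 <-].
apply: le_trans (l2norm_mulmx_frobenius A v) _.
by rewrite ler_piMr// frobenius_norm_ge0.
Qed.

Lemma l2norm_mulmx_unit A v : l2norm v <= 1 -> l2norm (A *m v) <= spectral_norm A.
Proof.
move=> v1; apply: ub_le_sup; first by have [] := spectral_norm_has_sup A.
by exists v.
Qed.

Lemma spectral_norm_ge0 A : 0 <= spectral_norm A.
Proof.
apply: le_trans (l2norm_mulmx_unit A (v := 0) _); first exact: l2norm_ge0.
by rewrite l2normE /sqnorm big1 ?sqrtr0// => i _; rewrite mxE expr0n.
Qed.

Lemma l2norm_mulmx A v : l2norm (A *m v) <= spectral_norm A * l2norm v.
Proof.
have [v0|v0] := eqVneq (l2norm v) 0.
  by apply: le_trans (l2norm_mulmx_frobenius A v) _; rewrite v0 !mulr0.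
have vp : 0 < l2norm v by rewrite lt_neqAle eq_sym v0 l2norm_ge0.
have := @l2norm_mulmx_unit A ((l2norm v)^-1 *: v).
rewrite -scalemxAr !l2normZ gtr0_norm ?invr_gt0// mulVf// => /(_ (lexx _)).
by rewrite mulrC ler_pdivrMr.
Qed.

Lemma spectral_le_frobenius A : spectral_norm A <= frobenius_norm A.
Proof.
apply: ge_sup; first by have [] := spectral_norm_has_sup A.
move=> _ [v /= v1 <-]; apply: le_trans (l2norm_mulmx_frobenius A v) _.
by rewrite ler_piMr// frobenius_norm_ge0.
Qed.

(** The columns of [A] are the images of the unit vectors. *)
Lemma sqF_le_spectral A : sqF A <= n%:R * spectral_norm A ^+ 2.
Proof.
rewrite /sqF exchange_big/= (_ : n%:R = \sum_(j < n) 1); last first.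
  by rewrite sumr_const card_ord.
rewrite mulr_suml; apply: ler_sum => j _; rewrite mul1r.
have -> : \sum_i A i j ^+ 2 = l2norm (A *m delta_mx j 0) ^+ 2.
  by rewrite l2norm_sqr; apply: eq_bigr => i _; rewrite mulmx_delta.
rewrite ler_sqr ?nnegrE ?l2norm_ge0 ?spectral_norm_ge0//; apply: l2norm_mulmx_unit.
rewrite l2normE sqnormE dot_delta mxE !eqxx sqrtr1//.
Qed.

Lemma frobenius_normD_le A B : frobenius_norm (A + B) <= frobenius_norm A + frobenius_norm B.
Proof.
rewrite -ler_sqr ?nnegrE ?addr_ge0 ?frobenius_norm_ge0// sqrrD !frobenius_norm_sqr.
pose c := \sum_(p : 'I_n * 'I_n) A p.1 p.2 * B p.1 p.2.
have -> : sqF (A + B) = sqF A + c *+ 2 + sqF B.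
  rewrite /c /sqF !pair_bigA/= -sumrMnl -!big_split/=; apply: eq_bigr => p _.
  by rewrite mxE sqrrD.
rewrite lerD2r lerD2l ler_pMn2r//; apply: le_trans (ler_norm _) _.
rewrite -ler_sqr ?nnegrE ?mulr_ge0 ?frobenius_norm_ge0// exprMn !frobenius_norm_sqr.
rewrite real_normK ?num_real// /c /sqF !pair_bigA/=.
exact: cauchy_schwarz_sum.
Qed.

End norm_facts.

Section covering.
Variables (R : realType) (n : nat).
Implicit Types (A B : 'M[R]_n) (J : set 'M[R]_n).

Lemma infinity_normP (M : R) A : 0 <= M -> infinity_norm A <= M <-> rowsum_le M A.
Proof.
move=> M0; rewrite /infinity_norm; split.
  move=> h i; apply: le_trans h.
  exact: (le_bigmax_cond 0 (fun i => \sum_j `|A i j|)).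
by move=> h; apply/bigmax_leP; split=> // i _; exact: h.
Qed.

Lemma entry_le (M : R) A i j : rowsum_le M A -> `|A i j| <= M.
Proof.
by move=> h; apply: le_trans (h i); rewrite (bigD1 j)//= lerDl sumr_ge0.
Qed.

(** Rounding the entries to a grid and keeping one representative in each
    occupied cell. *)
Lemma finite_spectral_cover J (M eps : R) : (0 < n)%N ->
  (forall A i j, J A -> `|A i j| <= M) -> 0 < eps ->
  exists2 N, finite_set N & eps_cover (@spectral_norm R n) J eps N.
Proof.
move=> n0 bJ e0.
pose h := eps / n%:R; have nR : 0 < n%:R :> R by rewrite ltr0n.
have h0 : 0 < h by rewrite divr_gt0.
pose K := Num.truncn (2 * M / h).
pose code A : {ffun 'I_n * 'I_n -> 'I_K.+1} :=
  [ffun p => inord (Num.truncn ((A p.1 p.2 + M) / h))].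
pose rep c := xget 0 [set A | J A /\ code A = c].
exists (rep @` [set c | exists2 A, J A & code A = c]).
  exact/finite_image/finite_finset.
have repP A : J A -> J (rep (code A)) /\ code (rep (code A)) = code A.
  by move=> JA; apply: (xgetPex 0 (P := [set B | J B /\ code B = code A])); exists A.
split=> [_ [c [A JA <-] <-]|A JA]; first by have [] := repP A JA.
have [JB cB] := repP A JA; set B := rep (code A) in JB cB.
exists B; first by exists (code A) => //; exists A.
apply: le_trans (spectral_le_frobenius _) _.
rewrite -ler_sqr ?nnegrE ?frobenius_norm_ge0 ?(ltW e0)// frobenius_norm_sqr.
apply: le_trans (_ : \sum_(i < n) \sum_(j < n) h ^+ 2 <= _); last first.
  rewrite !sumr_const !card_ord -mulrnA -[leLHS]mulr_natr natrM /h le_eqVlt.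
  apply/orP; left; apply/eqP.
  by field; rewrite lt0r_neq0.
apply: ler_sum => i _; apply: ler_sum => j _; rewrite !mxE.
rewrite -[leLHS]real_normK ?num_real// ler_sqr ?nnegrE ?(ltW h0)//.
have := congr1 (fun c : {ffun 'I_n * 'I_n -> 'I_K.+1} => val (c (i, j))) cB.
rewrite !ffunE/=.
have tr C : J C -> (Num.truncn ((C i j + M) / h) <= K)%N /\
    (Num.truncn ((C i j + M) / h))%:R <= (C i j + M) / h
       < (Num.truncn ((C i j + M) / h)).+1%:R.
  move=> JC; have := bJ C i j JC; rewrite ler_norml => /andP[c1 c2]; split.
    by apply: le_truncn; rewrite ler_pM2r ?invr_gt0//; lra.
  by apply: truncn_itv; rewrite divr_ge0 ?(ltW h0)//; lra.
have [b1 /andP[b2 b3]] := tr B JB; have [a1 /andP[a2 a3]] := tr A JA.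
rewrite !inordK// => e; rewrite e in b2 b3.
have : `|(B i j + M) / h - (A i j + M) / h| <= 1.
  by rewrite -natr1 in a3 b3; rewrite ler_norml; apply/andP; split; lra.
rewrite -mulrBl normrM [`|h^-1|]gtr0_norm ?invr_gt0// ler_pdivrMr// mul1r.
by rewrite (_ : B i j + M - (A i j + M) = B i j - A i j)//; ring.
Qed.

(** As soon as some finite cover exists the covering number is a true minimum. *)
Lemma covering_numberP J eps :
  (exists2 N, finite_set N & eps_cover (@spectral_norm R n) J eps N) ->
  exists s : seq 'M[R]_n,
  [/\ size s = covering_number (@spectral_norm R n) J eps,
      forall A, A \in s -> J A &
      forall A, J A -> exists2 B, B \in s & spectral_norm (B - A) <= eps].
Proof.
move=> [N0 [k0 Nk0] cN0].
pose cov k := exists2 N : set 'M[R]_n, (N #= `I_k)%card & eps_cover (@spectral_norm R n) J eps N.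
have ex : exists k, `[< cov k >] by exists k0; apply/asboolP; exists N0.
have [[N Nk [NJ cN]] _] : cov (covering_number (@spectral_norm R n) J eps) /\
   (forall m, cov m -> (covering_number (@spectral_norm R n) J eps <= m)%N).
  apply: (xgetPex 0%N (P := [set k | cov k /\ forall m, cov m -> (k <= m)%N])).
  exists (ex_minn ex); case: ex_minnP => m /asboolP cm mmin; split=> // l cl.
  by apply: mmin; apply/asboolP.
have fN : finite_set N by exists (covering_number (@spectral_norm R n) J eps).
have inN A : (A \in finmap.enum_fset (fset_set N)) = (A \in N).
  exact: (in_fset_set fN).
exists (finmap.enum_fset (fset_set N)); split.
- exact: card_fset_set Nk.
- by move=> A; rewrite inN inE; exact: NJ.
- by move=> A /cN[B NB AB]; exists B => //; rewrite inN inE.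
Qed.

End covering.

(** * The pseudo-likelihood *)

Section pseudo_likelihood.
Variables (R : realType) (n : nat).
Implicit Types (A J K : 'M[R]_n) (x : config n).

(** The negative log-pseudo-likelihood: the sum over the sites of minus the
    logarithm of the conditional probability of a spin given the others. *)
Definition pseudo_loss x J : R :=
  \sum_i softplus (- (2 * spin R x i 0 * (J *m spin R x) i 0)).

Lemma pseudo_loss_ge0 x J : 0 <= pseudo_loss x J.
Proof. by apply: sumr_ge0 => i _; exact: softplus_ge0. Qed.

Lemma pseudo_loss_convex x (s : R) J K : 0 <= s -> s <= 1 ->
  pseudo_loss x (s *: J + (1 - s) *: K)
    <= s * pseudo_loss x J + (1 - s) * pseudo_loss x K.
Proof.
move=> s0 s1; rewrite !mulr_sumr -big_split/=; apply: ler_sum => i _.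
apply: le_trans (softplus_convex _ _ s0 s1).
rewrite mulmxDl -!scalemxAl colD !colZ.
by rewrite le_eqVlt; apply/orP; left; apply/eqP; congr softplus; ring.
Qed.

Lemma sqnorm_spin x : sqnorm (spin R x) = n%:R.
Proof.
rewrite /sqnorm (eq_bigr (fun=> 1)) ?sumr_const ?card_ord// => i _.
exact: spin_sqr.
Qed.

(** The loss is Lipschitz in the local fields for the sum of absolute values, and the
    vector of spins has Euclidean norm [sqrt n]; Cauchy-Schwarz over the sites
    costs another [sqrt n]. *)
Lemma pseudo_loss_lipschitz x J K :
  `|pseudo_loss x J - pseudo_loss x K| <= 2 * n%:R * spectral_norm (J - K).
Proof.
rewrite -sumrB; apply: le_trans (ler_norm_sum _ _ _) _.
pose v := (J - K) *m spin R x.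
apply: le_trans (_ : \sum_i 2 * `|v i 0| <= _).
  apply: ler_sum => i _; apply: le_trans (softplus_lipschitz _ _) _.
  rewrite (_ : _ - _ = - (2 * (spin R x i 0 * v i 0))); last first.
    by rewrite /v mulmxBl colB; ring.
  by rewrite normrN !normrM spin_norm mul1r normr_nat.
rewrite -mulr_sumr -mulrA ler_wpM2l//.
rewrite -ler_sqr ?nnegrE ?mulr_ge0 ?spectral_norm_ge0//; last exact: sumr_ge0.
have := cauchy_schwarz_sum (fun i => `|v i 0|) (fun=> 1).
under eq_bigr do rewrite mulr1.
under [X in _ <= X * _ -> _]eq_bigr do rewrite real_normK ?num_real//.
under [X in _ <= _ * X -> _]eq_bigr do rewrite expr1n.
rewrite sumr_const card_ord -/(sqnorm v) -l2norm_sqr => h; apply: le_trans h _.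
have {}h : l2norm v ^+ 2 <= (spectral_norm (J - K) * l2norm (spin R x)) ^+ 2.
  rewrite ler_sqr ?nnegrE ?mulr_ge0 ?spectral_norm_ge0 ?l2norm_ge0//.
  exact: l2norm_mulmx.
rewrite exprMn (l2norm_sqr (spin R x)) sqnorm_spin in h.
apply: le_trans (ler_wpM2r (ler0n _ _) h) _.
by rewrite le_eqVlt; apply/orP; left; apply/eqP; ring.
Qed.

Lemma excess_le_pseudo_loss J A (M : R) x : 0 < M -> rowsum_le M J ->
  rowsum_le (2 * M) A ->
  excess J A (144 * expR M ^+ 4)^-1 x <= pseudo_loss x (J + A) - pseudo_loss x J.
Proof.
move=> M0 rJ rA; set k := (144 * _)^-1; rewrite /excess -sumrB.
rewrite /dot /sqnorm !mulr_sumr -big_split/=; apply: ler_sum => i _.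
have t1 := expR_ge1 M0; have Mt := le_expR M0.
set b := spin_image A x i 0.
have hb : `|b| <= 2 * M.
  rewrite /b /spin_image mxE; apply: le_trans (ler_norm_sum _ _ _) _.
  by apply: le_trans (rA i); apply: ler_sum => j _; rewrite normrM spin_norm mulr1.
set s := spin R x i 0; set z := - (2 * s * (J *m spin R x) i 0).
have -> : - (2 * s * ((J + A) *m spin R x) i 0) = z - 2 * s * b.
  by rewrite mulmxDl colD /z /b /spin_image; ring.
have s1 : `|s| = 1 by exact: spin_norm.
have := @softplus_strongly_convex R (expR M) z (- (2 * s * b)) t1 _ _ _.
rewrite -/k => H.
have {}H : softplus z + sigmoid z * - (2 * s * b) + k * (- (2 * s * b)) ^+ 2 <=
     softplus (z - 2 * s * b).
  apply: H.
  - rewrite /z -mulNr -mulrN; apply: (expR_field_le rJ); by rewrite normrN.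
  - by rewrite /z opprK; apply: (expR_field_le rJ).
  - by rewrite normrN !normrM s1 mulr1 normr_nat; lra.
have ss : s * s = 1 by rewrite -expr2 spin_sqr.
rewrite [score J x i 0]scoreE -/s -/z.
have -> : -2 * (s * sigmoid z * b) + 4 * k * b ^+ 2 =
   sigmoid z * - (2 * s * b) + k * (- (2 * s * b)) ^+ 2.
  rewrite (_ : (- (2 * s * b)) ^+ 2 = 4 * (s * s) * b ^+ 2); last by ring.
  by rewrite ss; ring.
by lra.
Qed.

End pseudo_likelihood.

(** * Deviation bound and estimation error *)

Section estimation.
Variable R : realType.

(** The tilt for which [moment_bootstrap] applies with the constant of
    [softplus_strongly_convex]. *)
Definition tilt_strength (M : R) : R :=
  (144 * expR M ^+ 4 * (768 * expR M ^+ 6) * (100 ^+ 2 * expR M ^+ 4))^-1.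

Definition curvature (M : R) : R :=
  (144 * expR M ^+ 4)^-1 / (8 * expR M ^+ 5).

Lemma tilt_strength_gt0 (M : R) : 0 < tilt_strength M.
Proof.
have t0 := expR_gt0 M; rewrite /tilt_strength invr_gt0.
apply: mulr_gt0; first by apply: mulr_gt0; apply: monomial_gt0.
by apply: mulr_gt0; apply: exprn_gt0 => //; rewrite ltr0n.
Qed.

Lemma curvature_gt0 (M : R) : 0 < curvature M.
Proof.
have t0 := expR_gt0 M; rewrite /curvature divr_gt0//.
  by rewrite invr_gt0; apply: monomial_gt0.
by apply: monomial_gt0.
Qed.

(** Chernoff's bound with a union bound over [s], written pointwise: at each [x]
    either the event holds or the exponential [bad K x] of some [K] is at least 1. *)
Lemma excess_deviation n (J : 'M[R]_n) (M delta : R) (s : seq 'M[R]_n)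
    (good : pred (config n)) :
  0 < M -> interaction_matrix J -> rowsum_le M J ->
  (forall K, K \in s -> interaction_matrix K /\ rowsum_le M K) ->
  0 < delta -> (0 < size s)%N ->
  (forall x, (forall K, K \in s -> curvature M * sqF (K - J) <=
     pseudo_loss x K - pseudo_loss x J
     + (ln (size s)%:R + ln delta^-1) / tilt_strength M) -> good x) ->
  1 - delta <= ising_prob J good.
Proof.
move=> M0 [symJ J0] rJ hs d0 s0 hgood.
set lam := tilt_strength M; set c := curvature M.
set T := ln (size s)%:R + ln delta^-1.
have lam0 : 0 < lam := tilt_strength_gt0 M.
have t0 := expR_gt0 M.
have w0 := ising_weight_gt0 J.
set k := (144 * expR M ^+ 4)^-1.
have D0 : 0 < 144 * expR M ^+ 4 :> R by apply: monomial_gt0.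
have k0 : 0 < k by rewrite invr_gt0.
have k1 : k <= 1.
  rewrite invf_le1//; have := exprn_ege1 4 (expR_ge1 M0); lra.
have eL : lam * 100 ^+ 2 * expR M ^+ 4 * (768 * expR M ^+ 6) = k.
  apply: cancel_factors; apply: lt0r_neq0.
  - exact: D0.
  - exact: monomial_gt0.
  - by apply: exprn_gt0; rewrite ltr0n.
  - exact: exprn_gt0.
have eT : expR (- T) = delta / (size s)%:R.
  rewrite /T opprD expRD !expRN !lnK ?posrE ?invr_gt0 ?ltr0n// invrK mulrC.
  by [].
pose bad K x := expR (- (lam * excess J (K - J) k x)) * expR (lam * (c * sqF (K - J)) - T).
have badE K : K \in s -> expect (ising_weight J) (bad K) <= delta / (size s)%:R.
  move=> /hs[[symK K0] rK].
  have symA : (K - J)^T = K - J by rewrite linearB/= symK symJ.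
  have A0 i : (K - J) i i = 0 by rewrite !mxE K0 J0 subr0.
  have rA : rowsum_le (2 * M) (K - J) by exact: rowsum_leB.
  rewrite (eq_expect _ (g := fun x => expR (lam * (c * sqF (K - J)) - T) *
      expR (- (lam * excess J (K - J) k x)))); last by move=> x; rewrite mulrC.
  rewrite expectZ mulrC.
  have := exponential_moment_excess symJ J0 rJ symA A0 rA M0 k0 k1 (ltW lam0) eL.
  move=> h; apply: le_trans (ler_wpM2r (expR_ge0 _) h) _.
  rewrite -expRD -eT ler_expR /c /curvature -/k.
  by rewrite addrA addNr add0r.
have key x : 1 <= (good x)%:R + \sum_(K <- s) bad K x.
  have b0 K y : 0 <= bad K y by rewrite mulr_ge0 ?expR_ge0.
  case gx : (good x); first by rewrite lerDl sumr_ge0.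
  have [K Ks hK] : exists2 K, K \in s & ~ (c * sqF (K - J) <=
     pseudo_loss x K - pseudo_loss x J + T / lam).
    apply: contrapT => /forall2NP h; move/negP: gx; apply; apply: hgood => K Ks.
    by have [//|/contrapT] := h K.
  rewrite add0r (big_rem K)//=; apply: le_trans (_ : bad K x <= _); last first.
    by rewrite lerDl sumr_ge0.
  rewrite /bad -expRD -(expR0 R) ler_expR.
  have [[symK K0] rK] := hs K Ks.
  have rA : rowsum_le (2 * M) (K - J) by exact: rowsum_leB.
  have := excess_le_pseudo_loss x M0 rJ rA; rewrite -/k [J + _]addrC subrK => he.
  move/negP: hK; rewrite -ltNge => /ltW hK.
  have /(ler_wpM2l (ltW lam0)) : excess J (K - J) k x + T / lam <= c * sqF (K - J) by lra.
  rewrite mulrDr [lam * (T / _)]mulrCA mulfV ?lt0r_neq0//; lra.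
have Ep : ising_prob J good = expect (ising_weight J) (fun x => (good x)%:R).
  rewrite /ising_prob /expect big_mkcond/=; congr (_ / _).
  by apply: eq_bigr => x _; case: (good x); rewrite ?mulr1 ?mulr0.
have : 1 <= expect (ising_weight J) (fun x => (good x)%:R + \sum_(K <- s) bad K x).
  by rewrite -[leLHS](expect_cst w0); apply: le_expect.
rewrite expectD -Ep => h.
suff : expect (ising_weight J) (fun x => \sum_(K <- s) bad K x) <= delta by lra.
have -> : expect (ising_weight J) (fun x => \sum_(K <- s) bad K x) =
    \sum_(K <- s) expect (ising_weight J) (bad K).
  rewrite /expect -mulr_suml exchange_big/=; congr (_ / _).
  by apply: eq_bigr => x _; rewrite mulr_sumr.
apply: le_trans (_ : \sum_(K <- s) delta / (size s)%:R <= _).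
  by rewrite !big_seq; apply: ler_sum => K Ks; exact: badE.
rewrite big_const_seq count_predT iter_addr_0 -[leLHS]mulr_natr mulfVK//.
by rewrite pnatr_eq0 -lt0n.
Qed.

End estimation.

Section error.
Variable R : realType.

(** [3 > e] follows from [exp (- 1) = exp (- 1 / 6) ^ 6 >= (5 / 6) ^ 6 > 1 / 3]. *)
Lemma ln3_gt1 : 1 < ln 3 :> R.
Proof.
rewrite -[X in X < _](@expRK R) ltr_ln ?posrE ?expR_gt0//.
have h := expR_ge1Dx (- 6^-1 : R).
have e : expR (-1) = expR (- 6^-1) ^+ 6 :> R.
  by rewrite -expRM_natl; congr expR; field.
have h6 : (5 / 6) ^+ 6 <= expR (-1) :> R.
  rewrite e; apply: lerXn2r; rewrite ?nnegrE ?expR_ge0//; lra.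
have e1 : expR 1 * expR (-1) = 1 :> R := expRxMexpNx_1 1.
have := expR_gt0 (1 : R); have : (1 / 3 : R) < (5 / 6) ^+ 6 by lra.
by nra.
Qed.

Definition loglog3 : R := ln (ln 3).

Lemma loglog3_gt0 : 0 < loglog3.
Proof. by rewrite ln_gt0// ln3_gt1. Qed.

Lemma loglog3_le n : (3 <= n)%N -> loglog3 <= ln (ln n%:R).
Proof.
move=> n3; have l3 := ln3_gt1.
have l3n : ln 3 <= ln n%:R :> R.
  by rewrite ler_ln ?posrE ?ltr0n ?ler_nat//; apply: leq_trans n3.
by rewrite ler_ln ?posrE//; lra.
Qed.

Definition curvature_factor : R := 144 * 8.
Definition tilt_factor : R := 144 * 768 * 100 ^+ 2.

(** Chosen so that the square of [rate] dominates both terms of [rate_bound]. *)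
Definition rate_factor : R :=
  (2 + 6 * curvature_factor) / loglog3 + 2 * (curvature_factor * tilt_factor).

Definition rate (M : R) : R := Num.sqrt rate_factor * expR M ^+ 12.

Lemma curvature_factor_gt0 : 0 < curvature_factor.
Proof. by rewrite mulr_gt0// ltr0n. Qed.

Lemma tilt_factor_gt0 : 0 < tilt_factor.
Proof. apply: mulr_gt0; first by apply: mulr_gt0; rewrite ltr0n.
by apply: exprn_gt0; rewrite ltr0n. Qed.

Lemma rate_factor_gt0 : 0 < rate_factor.
Proof.
have c0 := curvature_factor_gt0; have t0 := tilt_factor_gt0.
rewrite /rate_factor; move: curvature_factor tilt_factor c0 t0 => c t c0 t0.
have l0 := loglog3_gt0.
apply: addr_gt0; first by apply: divr_gt0 => //; lra.
by apply: mulr_gt0 => //; apply: mulr_gt0.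
Qed.

Lemma rate_singly_exponential : singly_exponential rate.
Proof.
exists (Num.sqrt rate_factor), 12; split=> //; first by rewrite sqrtr_gt0 rate_factor_gt0.
by move=> M M0; rewrite expRM_natl.
Qed.

Lemma curvatureV (M : R) : (curvature M)^-1 = curvature_factor * expR M ^+ 9.
Proof.
rewrite /curvature /curvature_factor invfM invrK -mulrA.
have -> : expR M ^+ 9 = expR M ^+ 4 * expR M ^+ 5 by rewrite -exprD.
by rewrite invrK; ring.
Qed.

Lemma tilt_strengthV (M : R) : (tilt_strength M)^-1 = tilt_factor * expR M ^+ 14.
Proof.
rewrite /tilt_strength /tilt_factor invrK.
have -> : expR M ^+ 14 = expR M ^+ 4 * expR M ^+ 6 * expR M ^+ 4 by rewrite -!exprD.
move: (expR M ^+ 4) (expR M ^+ 6) => u v.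
by move: (144 : R) (768 : R) (100 ^+ 2 : R) => p q r; ring.
Qed.

(** The rate absorbs the rounding error of the cover and the additive terms:
    both are bounded, while the iterated logarithm is bounded away from 0. *)
Lemma rate_bound (M T l : R) : 0 < M -> 0 <= T -> loglog3 <= l ->
  2 + 2 * ((3 + T / tilt_strength M) / curvature M) <= (rate M * Num.sqrt (T + l)) ^+ 2.
Proof.
move=> M0 T0 hl; have l0 := loglog3_gt0.
have c0 := curvature_factor_gt0; have t0 := tilt_factor_gt0.
rewrite exprMn /rate exprMn !sqr_sqrtr ?(ltW rate_factor_gt0)//; last by lra.
rewrite curvatureV tilt_strengthV /rate_factor -exprM/=.
move: curvature_factor tilt_factor c0 t0 => c t c0 t0.
set E := expR M; have E1 : 1 <= E := expR_ge1 M0.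
have p9 : E ^+ 9 <= E ^+ 24 by apply: ler_weXn2l.
have p23 : E ^+ 23 <= E ^+ 24 by apply: ler_weXn2l.
have p24 : 1 <= E ^+ 24 by apply: exprn_ege1.
have -> : 2 + 2 * ((3 + T * (t * E ^+ 14)) * (c * E ^+ 9))
   = 2 + 6 * c * E ^+ 9 + 2 * (c * t) * T * E ^+ 23.
  by rewrite (_ : E ^+ 23 = E ^+ 14 * E ^+ 9); [ring | rewrite -exprD].
have tl : 1 <= (T + l) / loglog3 by rewrite ler_pdivlMr//; lra.
apply: le_trans (_ : (2 + 6 * c) * E ^+ 24 * ((T + l) / loglog3)
   + 2 * (c * t) * (T + l) * E ^+ 24 <= _); last first.
  by rewrite le_eqVlt; apply/orP; left; apply/eqP; ring.
apply: lerD.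
  apply: le_trans (_ : (2 + 6 * c) * E ^+ 24 <= _).
    have : c * E ^+ 9 <= c * E ^+ 24 by rewrite ler_pM2l.
    by lra.
  by rewrite ler_peMr//; apply: mulr_ge0; lra.
have ct : 0 <= 2 * (c * t) by rewrite mulr_ge0// ltW// mulr_gt0.
apply: ler_pM => //.
- exact: mulr_ge0.
- by rewrite exprn_ge0; lra.
- by apply: ler_wpM2l => //; lra.
Qed.

Lemma near_minimizer_error n (J : set 'M[R]_n) (M : R)
    (Jhat : config n -> 'M[R]_n) (Jstar : 'M[R]_n) (delta : R) :
  0 < M -> (3 <= n)%N ->
  (forall A, J A -> interaction_matrix A /\ infinity_norm A <= M) ->
  (forall x, near_minimizer 1 (pseudo_loss x) J (Jhat x)) ->
  J Jstar -> 0 < delta -> delta < 1 ->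
  1 - delta <= ising_prob Jstar (fun x =>
    frobenius_norm (Jhat x - Jstar) <=
    rate M * Num.sqrt
      (ln (covering_number (@spectral_norm R n) J n%:R^-1)%:R
       + ln delta^-1 + ln (ln n%:R))).
Proof.
move=> M0 n3 bJ hmin Js d0 d1.
have n0 : (0 < n)%N by apply: leq_trans n3.
have nR : 0 < n%:R :> R by rewrite ltr0n.
have bJ' A : J A -> interaction_matrix A /\ rowsum_le M A.
  by move=> /bJ[iA]; split=> //; apply/infinity_normP => //; exact: ltW.
have [s [<- sJ cov]] : exists s : seq 'M[R]_n,
  [/\ size s = covering_number (@spectral_norm R n) J n%:R^-1,
      forall A, A \in s -> J A &
      forall A, J A -> exists2 B, B \in s & spectral_norm (B - A) <= n%:R^-1].
  apply: covering_numberP; apply: (@finite_spectral_cover _ _ _ M) => //.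
    by move=> A i j /bJ'[_]; exact: entry_le.
  by rewrite invr_gt0.
have s0 : (0 < size s)%N.
  by have [B Bs _] := cov _ Js; rewrite lt0n size_eq0; case: s Bs {sJ cov}.
have [iJ rJ] := bJ' _ Js.
apply: (@excess_deviation _ _ _ M delta s) => //.
  by move=> K /sJ/bJ'.
move=> x hx; have [Jx mx] := hmin x.
have [K Ks hK] := cov _ Jx.
set T := ln (size s)%:R + ln delta^-1.
have T0 : 0 <= T.
  apply: addr_ge0; apply: ln_ge0; first by rewrite ler1n.
  by rewrite invf_ge1// ltW.
have c0 := curvature_gt0 M; have l0 := tilt_strength_gt0 M.
have lip : pseudo_loss x K - pseudo_loss x (Jhat x) <= 2.
  apply: le_trans (ler_norm _) _; apply: le_trans (pseudo_loss_lipschitz _ _ _) _.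
  apply: le_trans (ler_wpM2l _ hK) _; first by rewrite mulr_ge0.
  by rewrite -mulrA mulfV ?mulr1// lt0r_neq0.
have hF : sqF (K - Jstar) <= (3 + T / tilt_strength M) / curvature M.
  rewrite ler_pdivlMr// mulrC; apply: le_trans (hx K Ks) _; rewrite -/T.
  by have := mx _ Js; lra.
have hr := rate_bound M0 T0 (loglog3_le n3).
set Z := _ / curvature M in hF hr.
have f1 : frobenius_norm (Jhat x - K) <= 1.
  rewrite -ler_sqr ?nnegrE ?frobenius_norm_ge0// frobenius_norm_sqr expr1n.
  have -> : sqF (Jhat x - K) = sqF (K - Jhat x).
    by apply: eq_bigr => i _; apply: eq_bigr => j _; rewrite !mxE -sqrrN opprB.
  apply: le_trans (sqF_le_spectral _) _.
  have hs := spectral_norm_ge0 (K - Jhat x).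
  have hs2 : spectral_norm (K - Jhat x) ^+ 2 <= n%:R^-1 ^+ 2.
    by rewrite ler_sqr ?nnegrE ?invr_ge0 ?(ltW nR).
  apply: le_trans (ler_wpM2l (ltW nR) hs2) _.
  by rewrite expr2 mulrA mulfV ?lt0r_neq0// mul1r invf_le1// ler1n.
have rM0 : 0 <= rate M by rewrite mulr_ge0 ?sqrtr_ge0 ?exprn_ge0 ?expR_ge0.
rewrite -ler_sqr ?nnegrE ?mulr_ge0 ?sqrtr_ge0 ?frobenius_norm_ge0//.
apply: le_trans hr.
have tri : frobenius_norm (Jhat x - Jstar) <=
    frobenius_norm (Jhat x - K) + frobenius_norm (K - Jstar).
  have := frobenius_normD_le (Jhat x - K) (K - Jstar).
  by rewrite addrA subrK.
have F0 := frobenius_norm_ge0 (Jhat x - Jstar).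
have G0 := frobenius_norm_ge0 (K - Jstar).
have hG : frobenius_norm (K - Jstar) ^+ 2 <= Z by rewrite frobenius_norm_sqr.
have h1 : frobenius_norm (Jhat x - Jstar) <= 1 + frobenius_norm (K - Jstar) by lra.
have h2 : frobenius_norm (Jhat x - Jstar) ^+ 2 <= (1 + frobenius_norm (K - Jstar)) ^+ 2.
  by rewrite ler_sqr ?nnegrE//; lra.
apply: le_trans h2 _.
have := sqr_ge0 (1 - frobenius_norm (K - Jstar)).
by rewrite sqrrB sqrrD; lra.
Qed.

End error.

(** * Projected gradient descent *)

Section frobenius_product.
Variables (R : realType) (n : nat).
Implicit Types A B C : 'M[R]_n.

Definition mdot A B : R := \sum_i \sum_j A i j * B i j.

Lemma sqFE A : sqF A = mdot A A.
Proof. by apply: eq_bigr => i _; apply: eq_bigr => j _; rewrite expr2. Qed.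

Lemma mdotC A B : mdot A B = mdot B A.
Proof. by apply: eq_bigr => i _; apply: eq_bigr => j _; rewrite mulrC. Qed.

Lemma mdotDl A B C : mdot (A + B) C = mdot A C + mdot B C.
Proof.
rewrite -big_split; apply: eq_bigr => i _; rewrite -big_split.
by apply: eq_bigr => j _; rewrite mxE mulrDl.
Qed.

Lemma mdotZl c A B : mdot (c *: A) B = c * mdot A B.
Proof.
rewrite mulr_sumr; apply: eq_bigr => i _; rewrite mulr_sumr.
by apply: eq_bigr => j _; rewrite mxE mulrA.
Qed.

Lemma sqFDZ A B c : sqF (A + c *: B) = sqF A + 2 * c * mdot A B + c ^+ 2 * sqF B.
Proof.
by rewrite !sqFE mdotDl !(mdotC _ (A + _)) !mdotDl !mdotZl !(mdotC _ (c *: B)) !mdotZl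
   (mdotC B A); ring.
Qed.

End frobenius_product.

Section projected_gradient.
Variables (R : realType) (n : nat) (J : set 'M[R]_n).
Implicit Types A B C D : 'M[R]_n.
Hypothesis cvxJ : convex_set J.

Lemma convex_combination A B (s : R) : J A -> J B -> 0 <= s -> s <= 1 ->
  J (s *: A + (1 - s) *: B).
Proof.
move=> JA JB s0 s1; have := @cvxJ A B (Itv01 s0 s1).
by rewrite !inE => /(_ JA JB).
Qed.

Variable P : 'M[R]_n -> 'M[R]_n.
Hypothesis projP : projection_onto J P.

Lemma projection_in B : J (P B). Proof. by have [] := projP B. Qed.

(** The first-order optimality condition at the projection: moving from [P B]
    towards [C] by a small fraction stays in [J] and cannot reduce the distance
    to [B]. *)
Lemma projection_obtuse B C : J C -> 0 <= mdot (P B - B) (C - P B).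
Proof.
move=> JC; have [JP minP] := projP B.
set a := mdot _ _; set b := sqF (C - P B).
have h s : 0 < s -> s <= 1 -> 0 <= 2 * a + s * b.
  move=> s0 s1; have := minP _ (convex_combination JC JP (ltW s0) s1).
  have -> : s *: C + (1 - s) *: P B - B = (P B - B) + s *: (C - P B).
    by apply/matrixP => i j; rewrite !mxE; ring.
  rewrite !frobenius_normE ler_sqrt ?sqF_ge0// sqFDZ -/a -/b => h.
  have : 0 <= s * (2 * a + s * b) by lra.
  by rewrite pmulr_rge0.
have b0 : 0 <= b := sqF_ge0 _.
rewrite leNgt; apply/negP => a0.
have s0 : 0 < - a / (- a + b) by rewrite divr_gt0; lra.
have s1 : - a / (- a + b) <= 1 by rewrite ler_pdivrMr; lra.
have := h _ s0 s1.
have : - a / (- a + b) * b <= - a.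
  by rewrite mulrAC ler_pdivrMr; [rewrite mulrDr ler_wpDl ?sqr_ge0// -expr2 sqr_ge0 | lra].
by lra.
Qed.

Lemma projection_nonexpansive B C : J C -> sqF (P B - C) <= sqF (B - C).
Proof.
move=> JC; have := projection_obtuse B JC.
have -> : B - C = (P B - C) + (-1) *: (P B - B).
  by apply/matrixP => i j; rewrite !mxE; ring.
have e : mdot (P B - B) (C - P B) = - mdot (P B - C) (P B - B).
  rewrite (_ : C - P B = (-1) *: (P B - C)); last first.
    by apply/matrixP => i j; rewrite !mxE; ring.
  by rewrite mdotC mdotZl; ring.
by rewrite sqFDZ e; have := sqF_ge0 (P B - B); lra.
Qed.

Variables (x : config n) (M eta : R) (m : nat).
Hypothesis M_gt0 : 0 < M.
Hypothesis eta_gt0 : 0 < eta.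
Hypothesis boundJ : forall A, J A -> rowsum_le M A.
Hypothesis m_large : 4 * M <= m%:R.

(** The logistic function with its exponential replaced by [(1 + z / m) ^ m]. *)
Definition approx_sigmoid (A : 'M[R]_n) i : R :=
  (1 + (1 + 2 * spin R x i 0 * (A *m spin R x) i 0 / m%:R) ^+ m)^-1.

Definition descent_step A : 'M[R]_n :=
  \matrix_(i, j) (A i j +
     eta * (2 * spin R x i 0 * approx_sigmoid A i) * spin R x j 0).

Fixpoint iterate t : 'M[R]_n :=
  if t is t'.+1 then P (descent_step (iterate t')) else P 0.

Fixpoint average t : 'M[R]_n :=
  if t is t'.+1 then average t' + t'.+1%:R^-1 *: (iterate t' - average t') else 0.

Lemma iterate_in t : J (iterate t).
Proof. by case: t => [|t]; exact: projection_in. Qed.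

Lemma m_gt0 : 0 < m%:R :> R.
Proof. by have := M_gt0; have := m_large; lra. Qed.

Lemma local_field_bound A i : J A -> `|2 * spin R x i 0 * (A *m spin R x) i 0| <= 2 * M.
Proof.
move=> /boundJ rA; rewrite !normrM spin_norm mulr1 normr_nat ler_pM2l//.
exact: (local_field_le rA).
Qed.

(** [(1 + z / m) ^ m] is the exponential of [m * ln (1 + z / m)], so the error is that
    of the logarithm, through the Lipschitz bound on the sigmoid. *)
Lemma approx_sigmoid_error A i : J A ->
  `|sigmoid (- (2 * spin R x i 0 * (A *m spin R x) i 0)) - approx_sigmoid A i|
    <= 8 * M ^+ 2 / m%:R /\ 0 <= approx_sigmoid A i <= 1.
Proof.
move=> JA; have := local_field_bound i JA; rewrite /approx_sigmoid.
set z := 2 * _ * _ => hz; have mp := m_gt0; have M0 := M_gt0.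
pose y := z / m%:R; rewrite -/y.
have hy : `|y| <= 2^-1.
  rewrite normrM normfV normr_nat ler_pdivrMr//; have := m_large; lra.
have y1 : 2^-1 <= 1 + y by move: hy; rewrite ler_norml => /andP[]; lra.
have y0 : 0 < 1 + y by lra.
have p0 : 0 < (1 + y) ^+ m by rewrite exprn_gt0.
have eE : (1 + (1 + y) ^+ m)^-1 = sigmoid (- (m%:R * ln (1 + y))).
  by rewrite /sigmoid opprK expRM_natl lnK ?posrE.
split; last by rewrite invr_ge0 invf_le1; lra.
rewrite eE; apply: le_trans (sigmoid_lipschitz _ _) _.
have zy : z = m%:R * y by rewrite /y mulrCA mulfV ?mulr1// lt0r_neq0.
rewrite -opprD normrN {1}zy -mulrBr normrM normr_nat.
have l1 : ln (1 + y) <= y by apply: le_ln1Dx; lra.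
have l2 : y - ln (1 + y) <= 2 * y ^+ 2.
  have := @ln_le_subr1 R (1 + y)^-1; rewrite invr_gt0 => /(_ y0).
  rewrite lnV ?posrE// => h.
  apply: le_trans (_ : y + ((1 + y)^-1 - 1) <= _); first by lra.
  have -> : y + ((1 + y)^-1 - 1) = y ^+ 2 / (1 + y) by field; rewrite lt0r_neq0.
  by rewrite ler_pdivrMr//; have := sqr_ge0 y; nra.
rewrite ger0_norm; last by lra.
apply: le_trans (ler_wpM2l (ltW mp) l2) _.
have -> : m%:R * (2 * y ^+ 2) = 2 * z ^+ 2 / m%:R by rewrite /y; field; rewrite lt0r_neq0.
rewrite ler_pM2r ?invr_gt0//.
have : z ^+ 2 <= (2 * M) ^+ 2.
  by rewrite -[leLHS]real_normK ?num_real// ler_sqr ?nnegrE//; lra.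
by rewrite exprMn; lra.
Qed.

Lemma sum_diff_le A B : J A -> J B -> \sum_i \sum_j `|(A - B) i j| <= n%:R * (2 * M).
Proof.
move=> /boundJ rA /boundJ rB.
apply: le_trans (_ : \sum_(i < n) 2 * M <= _); last first.
  by rewrite sumr_const card_ord -[leLHS]mulr_natl.
by apply: ler_sum => i _; exact: rowsum_leB.
Qed.

Lemma sqF_diff_le A B : J A -> J B -> sqF (A - B) <= n%:R * (4 * M ^+ 2).
Proof.
move=> /boundJ rA /boundJ rB.
apply: le_trans (_ : \sum_(i < n) 4 * M ^+ 2 <= _); last first.
  by rewrite sumr_const card_ord -[leLHS]mulr_natl.
apply: ler_sum => i _.
by apply: le_trans (row_sqr_le i (rowsum_leB rA rB)) _; rewrite exprMn; lra.
Qed.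

(** One step of the standard analysis: a step along the negative approximate gradient
    [Gh], the nonexpansive projection, and convexity in the form of the tangent
    inequality.  The entries of [Gh] are at most 2 whatever [M] is. *)
Lemma descent_progress A B : J A -> J B ->
  2 * eta * (pseudo_loss x A - pseudo_loss x B) <=
  sqF (A - B) - sqF (P (descent_step A) - B)
  + eta ^+ 2 * (4 * n%:R ^+ 2) + 2 * eta * (32 * n%:R * M ^+ 3 / m%:R).
Proof.
move=> JA JB; have M0 := M_gt0; have e0 := eta_gt0.
pose s := spin R x; pose err : R := 8 * M ^+ 2 / m%:R.
pose G : 'M[R]_n := \matrix_(i, j)
  (- (2 * s i 0 * s j 0 * sigmoid (- (2 * s i 0 * (A *m s) i 0)))).
pose Gh : 'M[R]_n := \matrix_(i, j) (- (2 * s i 0 * s j 0 * approx_sigmoid A i)).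
have stepE : descent_step A - B = (A - B) + (- eta) *: Gh.
  by apply/matrixP => i j; rewrite !mxE -/s; ring.
have h1 := projection_nonexpansive (descent_step A) JB.
rewrite stepE sqFDZ in h1.
have h2 : sqF Gh <= 4 * n%:R ^+ 2.
  apply: le_trans (_ : \sum_(i < n) \sum_(j < n) (4 : R) <= _); last first.
    by rewrite !sumr_const !card_ord -mulrnA -[leLHS]mulr_natr natrM expr2.
  apply: ler_sum => i _; apply: ler_sum => j _.
  have [_ /andP[a0 a1]] := approx_sigmoid_error i JA.
  rewrite [Gh i j]mxE sqrrN !exprMn !spin_sqr !mulr1.
  have : approx_sigmoid A i ^+ 2 <= 1 by rewrite expr_le1.
  by lra.
have h3 : pseudo_loss x A - pseudo_loss x B <= mdot G (A - B).
  rewrite -sumrB; apply: ler_sum => i _.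
  have := softplus_ge_tangent (- (2 * s i 0 * (A *m s) i 0))
     (- (2 * s i 0 * ((B - A) *m s) i 0)).
  have -> : - (2 * s i 0 * (A *m s) i 0) + - (2 * s i 0 * ((B - A) *m s) i 0) =
    - (2 * s i 0 * (B *m s) i 0) by rewrite mulmxBl colB; ring.
  have -> : \sum_j G i j * (A - B) i j =
    - (sigmoid (- (2 * s i 0 * (A *m s) i 0)) * - (2 * s i 0 * ((B - A) *m s) i 0)).
    rewrite [((B - A) *m s) i 0]mxE !mulr_sumr -sumrN mulr_sumr -sumrN.
    by apply: eq_bigr => j _; rewrite !mxE -/s; ring.
  rewrite -/s; lra.
have h4 : mdot G (A - B) <= mdot Gh (A - B) + 2 * err * (n%:R * (2 * M)).
  apply: le_trans (_ : mdot Gh (A - B) +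
      2 * err * \sum_i \sum_j `|(A - B) i j| <= _); last first.
    rewrite lerD2l; apply: ler_wpM2l; last exact: sum_diff_le.
    by rewrite mulr_ge0// divr_ge0// mulr_ge0// sqr_ge0.
  rewrite mulr_sumr -big_split/=; apply: ler_sum => i _.
  rewrite mulr_sumr -big_split/=; apply: ler_sum => j _.
  have [a0 _] := approx_sigmoid_error i JA.
  rewrite -lerBlDl -mulrBl; apply: le_trans (ler_norm _) _; rewrite normrM.
  apply: ler_wpM2r => //; rewrite [G i j]mxE [Gh i j]mxE -opprB opprK addrC -mulrBr.
  by rewrite normrN !normrM !spin_norm !mulr1 normr_nat ler_pM2l.
have e : 2 * err * (n%:R * (2 * M)) = 32 * n%:R * M ^+ 3 / m%:R.
  by rewrite /err; field; rewrite lt0r_neq0// m_gt0.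
rewrite e in h4; rewrite (mdotC (A - B)) in h1.
have h5 := ler_wpM2l (sqr_ge0 eta) h2; rewrite sqrrN in h1.
have h6 : pseudo_loss x A - pseudo_loss x B <= mdot Gh (A - B) + 32 * n%:R * M ^+ 3 / m%:R.
  by lra.
have e2 : 0 <= 2 * eta by lra.
have := ler_wpM2l e2 h6; lra.
Qed.

Lemma sum_progress B t : J B ->
  2 * eta * \sum_(r < t) (pseudo_loss x (iterate r) - pseudo_loss x B) <=
  sqF (iterate 0 - B) - sqF (iterate t - B) +
  t%:R * (eta ^+ 2 * (4 * n%:R ^+ 2) + 2 * eta * (32 * n%:R * M ^+ 3 / m%:R)).
Proof.
move=> JB; elim: t => [|t IH]; first by rewrite big_ord0; lra.
rewrite big_ord_recr/= -natr1 mulrDr.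
have := descent_progress (iterate_in t) JB; move: IH => /=; lra.
Qed.

Lemma average_step t : average t.+1 =
  t.+1%:R^-1 *: iterate t + (1 - t.+1%:R^-1) *: average t.
Proof. by apply/matrixP => i j; rewrite !mxE; ring. Qed.

Lemma invS_le1 t : t.+1%:R^-1 <= 1 :> R.
Proof. by rewrite invf_le1 ?ltr0n// ler1n. Qed.

Lemma average_in t : J (average t.+1).
Proof.
elim: t => [|t IH].
  by rewrite average_step invr1 subrr scale1r scale0r addr0; exact: iterate_in.
rewrite average_step; apply: convex_combination IH _ _; first exact: iterate_in.
  by rewrite invr_ge0 ler0n.
exact: invS_le1.
Qed.

Lemma average_loss_le t :
  t%:R * pseudo_loss x (average t) <= \sum_(r < t) pseudo_loss x (iterate r).
Proof.
elim: t => [|t IH]; first by rewrite big_ord0 mul0r.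
rewrite big_ord_recr average_step; have t0 : 0 < t.+1%:R :> R by rewrite ltr0n.
have i0 : 0 <= t.+1%:R^-1 :> R by rewrite invr_ge0 ler0n.
have := pseudo_loss_convex x (iterate t) (average t) i0 (invS_le1 t).
move=> /(ler_wpM2l (ltW t0)) h; apply: le_trans h _.
rewrite mulrDr !mulrA mulfV ?lt0r_neq0// mul1r addrC; apply: lerD => //.
apply: le_trans IH; rewrite mulrBr mulr1 mulfV ?lt0r_neq0//.
by rewrite -natr1 addrK.
Qed.

(** With this step size the gradient term contributes [eps / 2]; the two terms of the
    lower bound on [m] are the initial distance and the approximation error. *)
Lemma average_near_minimizer (eps : R) : 0 < eps -> (0 < n)%N ->
  eta = eps / (4 * n%:R ^+ 2) ->
  16 * n%:R ^+ 3 * M ^+ 2 / eps ^+ 2 + 64 * n%:R * M ^+ 3 / eps <= m%:R ->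
  near_minimizer eps (pseudo_loss x) J (average m).
Proof.
move=> e0 n0 etaE hm; have mp := m_gt0.
split.
  by have := mp; rewrite ltr0n; case: (m) => // k _; exact: average_in.
move=> B JB; have h1 := sum_progress m JB; have h2 := average_loss_le m.
have h3 := sqF_diff_le (iterate_in 0) JB; have h4 := sqF_ge0 (iterate m - B).
rewrite sumrB sumr_const card_ord -[_ *+ m]mulr_natl in h1.
have nR : 0 < n%:R :> R by rewrite ltr0n.
have et0 := eta_gt0.
set a := pseudo_loss x (average m) in h2 *; set b := pseudo_loss x B in h1 *.
have h5 : 2 * eta * (m%:R * a - m%:R * b) <= n%:R * (4 * M ^+ 2)
   + m%:R * (eta ^+ 2 * (4 * n%:R ^+ 2) + 2 * eta * (32 * n%:R * M ^+ 3 / m%:R)).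
  apply: le_trans (_ : 2 * eta * (\sum_(r < m) pseudo_loss x (iterate r) - m%:R * b) <= _).
    by apply: ler_wpM2l; lra.
  by move: h1; lra.
have h6 : m%:R * (a - b) <= m%:R * eps.
  rewrite -(ler_pM2l (_ : 0 < 2 * eta)); last by lra.
  rewrite mulrBr; apply: le_trans h5 _.
  have -> : m%:R * (eta ^+ 2 * (4 * n%:R ^+ 2) + 2 * eta * (32 * n%:R * M ^+ 3 / m%:R)) =
      m%:R * eta * eps + 64 * eta * n%:R * M ^+ 3.
    by rewrite etaE; field; rewrite !lt0r_neq0.
  have -> : n%:R * (4 * M ^+ 2) = eta * eps * (16 * n%:R ^+ 3 * M ^+ 2 / eps ^+ 2).
    by rewrite etaE; field; rewrite !lt0r_neq0.
  have -> : 64 * eta * n%:R * M ^+ 3 = eta * eps * (64 * n%:R * M ^+ 3 / eps).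
    by field; rewrite lt0r_neq0.
  have := ler_wpM2l (ltW (mulr_gt0 et0 e0)) hm; rewrite mulrDr.
  by lra.
rewrite ler_pM2l// in h6; lra.
Qed.

End projected_gradient.

(** * Programs *)

Section total_correctness.
Variables (R : realType) (n : nat) (P : 'M[R]_n -> 'M[R]_n) (tau : nat).
Implicit Types (c : program) (s : store R) (Q I : store R -> Prop).

(** Total correctness with a bound on the running time. *)
Definition runs c s (T : nat) Q :=
  exists t s', [/\ exec P tau c s t s', (t <= T)%N & Q s'].

Lemma runs_weaken c s T T' Q Q' : runs c s T Q -> (T <= T')%N ->
  (forall s', Q s' -> Q' s') -> runs c s T' Q'.
Proof.
move=> [t [s' [e tT q]]] TT qq; exists t, s'; split=> //; last exact: qq.
exact: leq_trans TT.
Qed.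

Lemma runs_seq c1 c2 s T1 T2 Q1 Q2 : runs c1 s T1 Q1 ->
  (forall s', Q1 s' -> runs c2 s' T2 Q2) -> runs (Seq c1 c2) s (T1 + T2) Q2.
Proof.
move=> [t1 [s1 [e1 h1 q1]]] /(_ _ q1)[t2 [s2 [e2 h2 q2]]].
by exists (t1 + t2)%N, s2; split=> //; [exact: exec_seq e2 | exact: leq_add].
Qed.

Lemma runs_set_reg s r e Q : Q (set_reg s r (eval_nat s e)) ->
  runs (SetReg r e) s 1 Q.
Proof. by move=> q; eexists _, _; split; [exact: exec_set_reg | |]. Qed.

Lemma runs_set_cell s a i j e Q :
  Q (set_cell s a (eval_nat s i) (eval_nat s j) (eval_real s e)) ->
  runs (SetCell a i j e) s 1 Q.
Proof. by move=> q; eexists _, _; split; [exact: exec_set_cell | |]. Qed.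

Lemma runs_project s a Q : Q (write_matrix s a (P (read_matrix n s a))) ->
  runs (Project a) s tau.+1 Q.
Proof. by move=> q; eexists _, _; split; [exact: exec_project | |]. Qed.

Lemma runs_set_reg_seq s r e c T Q : runs c (set_reg s r (eval_nat s e)) T Q ->
  runs (Seq (SetReg r e) c) s T.+1 Q.
Proof.
by move=> h; apply: (@runs_seq _ _ _ 1 T (eq (set_reg s r (eval_nat s e)))) => [|_ <- //];
   exact: runs_set_reg.
Qed.

Lemma runs_set_cell_seq s a i j e c T Q :
  runs c (set_cell s a (eval_nat s i) (eval_nat s j) (eval_real s e)) T Q ->
  runs (Seq (SetCell a i j e) c) s T.+1 Q.
Proof.
by move=> h; apply: (@runs_seq _ _ _ 1 T
  (eq (set_cell s a (eval_nat s i) (eval_nat s j) (eval_real s e)))) => [|_ <- //];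
   exact: runs_set_cell.
Qed.

Lemma runs_for b c N T (I : nat -> store R -> Prop) s :
  (forall k s, (k < N)%N -> I k s -> eval_test s b /\ runs c s T (I k.+1)) ->
  (forall s, I N s -> ~~ eval_test s b) ->
  I 0%N s -> runs (While b c) s (N * T.+1).+1 (I N).
Proof.
move=> body stop I0.
suff loop k s' : (k <= N)%N -> I (N - k)%N s' ->
    runs (While b c) s' (k * T.+1).+1 (I N).
  by apply: loop => //; rewrite subnn.
elim: k s' {I0} => [|k IH] s' kN.
  rewrite subn0 => Is; exists 1%N, s'; split=> //.
  by apply: exec_while_false; exact: stop.
move=> Is; have Nk : (N - k.+1 < N)%N by rewrite ltn_subrL//; apply: leq_trans kN.
have [tst [t1 [s1 [e1 h1 I1]]]] := body _ _ Nk Is.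
have I1' : I (N - k)%N s1 by rewrite -subnSK.
have [t2 [s2 [e2 h2 I2]]] := IH s1 (ltnW kN) I1'.
exists (t1 + t2).+1, s2; split=> //; first exact: exec_while_true e2.
by rewrite mulSn ltnS; lia.
Qed.

End total_correctness.

Definition scalar a := RCell a (NConst 0) (NConst 0).
Definition numeral k := RNat (NConst k).
Definition increment r := SetReg r (NAdd (NReg r) (NConst 1)).

(** Array 3 holds the average, array 4 the iterate, and arrays 6, 7 and 8 the
    scalars: the bound on the number of steps, the current local field and the
    current power.  Registers 1 and 2 are the row and the column, 3 counts the
    steps, 4 counts the factors of the power, and 5 holds the number of steps. *)
Definition step_bound_expr : real_expr :=
  let n := RNat (NReg 0) in
  let M := scalar 0 in
  let eps := scalar 1 in
  RAdd (RAdd (numeral 1) (RMul (numeral 4) M))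
    (RAdd
      (RDiv (RMul (RMul (numeral 16) (RMul n (RMul n n))) (RMul M M)) (RMul eps eps))
      (RDiv (RMul (RMul (numeral 64) n) (RMul M (RMul M M))) eps)).

Definition field_body : program :=
  Seq (SetCell 7 (NConst 0) (NConst 0)
        (RAdd (scalar 7) (RMul (RCell 4 (NReg 1) (NReg 2)) (RCell 2 (NReg 2) (NConst 0)))))
  (Seq (SetCell 3 (NReg 1) (NReg 2)
        (RAdd (RCell 3 (NReg 1) (NReg 2))
          (RMul (RDiv (numeral 1) (RNat (NAdd (NReg 3) (NConst 1))))
             (RSub (RCell 4 (NReg 1) (NReg 2)) (RCell 3 (NReg 1) (NReg 2))))))
  (increment 2)).

Definition exp_body : program :=
  Seq (SetCell 8 (NConst 0) (NConst 0)
        (RMul (scalar 8) (RAdd (numeral 1)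
          (RDiv (RMul (RMul (numeral 2) (RCell 2 (NReg 1) (NConst 0))) (scalar 7))
                (RNat (NReg 5))))))
  (increment 4).

Definition update_body : program :=
  Seq (SetCell 4 (NReg 1) (NReg 2)
        (RAdd (RCell 4 (NReg 1) (NReg 2))
          (RMul (RMul
             (RDiv (scalar 1) (RMul (numeral 4) (RMul (RNat (NReg 0)) (RNat (NReg 0)))))
             (RMul (RMul (numeral 2) (RCell 2 (NReg 1) (NConst 0)))
                   (RDiv (numeral 1) (RAdd (numeral 1) (scalar 8)))))
             (RCell 2 (NReg 2) (NConst 0)))))
  (increment 2).

(** The update of row [i] reads only row [i] of the iterate, so the rows are overwritten
    in place; the average is updated first, while the row is still the old one. *)
Definition row_body : program :=
  Seq (SetCell 7 (NConst 0) (NConst 0) (numeral 0))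
  (Seq (SetReg 2 (NConst 0))
  (Seq (While (TNatLt (NReg 2) (NReg 0)) field_body)
  (Seq (SetCell 8 (NConst 0) (NConst 0) (numeral 1))
  (Seq (SetReg 4 (NConst 0))
  (Seq (While (TNatLt (NReg 4) (NReg 5)) exp_body)
  (Seq (SetReg 2 (NConst 0))
  (Seq (While (TNatLt (NReg 2) (NReg 0)) update_body)
  (increment 1)))))))).

Definition step_body : program :=
  Seq (SetReg 1 (NConst 0))
  (Seq (While (TNatLt (NReg 1) (NReg 0)) row_body)
  (Seq (Project 4) (increment 3))).

Definition algorithm : program :=
  (* Register 5 climbs to the least integer that is not below the bound. *)
  Seq (SetCell 6 (NConst 0) (NConst 0) step_bound_expr)
  (Seq (While (TRealLt (RNat (NReg 5)) (scalar 6)) (increment 5))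
  (Seq (Project 4)
  (While (TNatLt (NReg 3) (NReg 5)) step_body))).

Section verification.
Variables (R : realType) (n : nat) (P : 'M[R]_n -> 'M[R]_n) (tau : nat).
Variables (M eps : R) (x : config n) (m : nat).

Local Notation eta := (eps / (4 * n%:R ^+ 2)).
Local Notation Jt := (iterate P x eta m).
Local Notation St := (average P x eta m).
Local Notation step := (descent_step x eta m).
Local Notation sp := (spin R x).
Local Notation runs := (runs P tau).

Definition inputs_kept (s : store R) : Prop :=
  [/\ reg s 0 = n, cell s 0 0 0 = M, cell s 1 0 0 = eps &
      forall i : 'I_n, cell s 2 i 0 = sp i 0].

Definition before i j (a b : nat) : bool := (a < i)%N || (a == i) && (b < j)%N.

Lemma beforeS i j a b : before i j.+1 a b = before i j a b || (a == i) && (b == j).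
Proof. by rewrite /before ltnS [(b <= j)%N]leq_eqVlt [(b == j) || _]orbC andb_orr orbA. Qed.

(** In step [t] the averages are written up to position [(i, j3)] and the
    iterates up to position [(i, j4)] in the row-major order. *)
Definition partially_done t i j3 j4 (s : store R) : Prop :=
  [/\ inputs_kept s, reg s 5 = m, reg s 3 = t, reg s 1 = i &
   (forall a b : 'I_n, cell s 3 a b = if before i j3 a b then St t.+1 a b else St t a b) /\
   (forall a b : 'I_n, cell s 4 a b = if before i j4 a b then step (Jt t) a b else Jt t a b)].

Lemma sum_ltnS (F : 'I_n -> R) (j : 'I_n) :
  \sum_(b < n | (b < j.+1)%N) F b = \sum_(b < n | (b < j)%N) F b + F j.
Proof.
rewrite (bigD1 j)//= addrC; congr (_ + _); apply: eq_bigl => b.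
by rewrite ltnS ltn_neqAle -val_eqE/= andbC.
Qed.

Definition field_inv t (i : 'I_n) j s : Prop :=
  [/\ partially_done t i j 0 s, reg s 2 = j &
      cell s 7 0 0 = \sum_(b < n | (b < j)%N) Jt t i b * sp b 0].

Lemma field_body_ok t (i j : 'I_n) s : field_inv t i j s ->
  runs field_body s 3 (field_inv t i j.+1).
Proof.
move=> [[[r0 c0 c1 c2] r5 r3 r1 [h3 h4]] r2 c7].
apply: runs_set_cell_seq; apply: runs_set_cell_seq; apply: runs_set_reg => /=.
rewrite r1 r2 r3 c2 c7 (h3 i j) (h4 i j) /before !ltnn !andbF/=.
split=> /=; last by rewrite sum_ltnS.
  split=> //=; split=> a b; last exact: h4.
  rewrite -/(before i j.+1 a b) beforeS (h3 a b).
  case: andP => [[/eqP ai /eqP bj]|nab]; last by rewrite orbF.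
  have {ai} -> : a = i by exact: val_inj.
  have {bj} -> : b = j by exact: val_inj.
  by rewrite orbT !mxE addn1 mul1r.
by rewrite addn1.
Qed.

Definition power_inv t (i : 'I_n) k s : Prop :=
  [/\ partially_done t i n 0 s, reg s 4 = k, cell s 7 0 0 = (Jt t *m sp) i 0 &
      cell s 8 0 0 = (1 + 2 * sp i 0 * (Jt t *m sp) i 0 / m%:R) ^+ k].

Lemma exp_body_ok t (i : 'I_n) k s : power_inv t i k s ->
  runs exp_body s 2 (power_inv t i k.+1).
Proof.
move=> [[[r0 c0 c1 c2] r5 r3 r1 [h3 h4]] r4 c7 c8].
apply: runs_set_cell_seq; apply: runs_set_reg => /=.
rewrite r1 r4 r5 c2 c7 c8; split=> //=.
  by rewrite addn1.
by rewrite -exprSr.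
Qed.

Definition update_inv t (i : 'I_n) j s : Prop :=
  [/\ partially_done t i n j s, reg s 2 = j &
      cell s 8 0 0 = (1 + 2 * sp i 0 * (Jt t *m sp) i 0 / m%:R) ^+ m].

Lemma update_body_ok t (i j : 'I_n) s : update_inv t i j s ->
  runs update_body s 2 (update_inv t i j.+1).
Proof.
move=> [[[r0 c0 c1 c2] r5 r3 r1 [h3 h4]] r2 c8].
apply: runs_set_cell_seq; apply: runs_set_reg => /=.
rewrite r0 r1 r2 c1 !c2 c8 (h4 i j) /before !ltnn !andbF/=.
split=> //=; last by rewrite addn1.
split=> //=; split=> a b; first exact: h3.
rewrite -/(before i j.+1 a b) beforeS (h4 a b).
case: andP => [[/eqP ai /eqP bj]|nab]; last by rewrite orbF.
have {ai} -> : a = i by exact: val_inj.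
have {bj} -> : b = j by exact: val_inj.
by rewrite orbT [RHS]mxE /approx_sigmoid mul1r -expr2.
Qed.

Lemma before_row i (a b : 'I_n) : before i n a b = before i.+1 0 a b.
Proof. by rewrite /before ltn_ord ltn0 andbT andbF orbF ltnS [RHS]leq_eqVlt orbC. Qed.

Definition row_time := (1 + (1 + ((n * 4).+1 + (1 + (1 + ((m * 3).+1 + (1 +
   ((n * 3).+1 + 1))))))))%N.

Lemma row_body_ok t (i : 'I_n) s : partially_done t i 0 0 s ->
  runs row_body s row_time (partially_done t i.+1 0 0).
Proof.
move=> [[r0 c0 c1 c2] r5 r3 r1 [h3 h4]].
apply: runs_set_cell_seq; apply: runs_set_reg_seq.
apply: (runs_seq (Q1 := field_inv t i n)).
  apply: (runs_for (I := field_inv t i)).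
  - move=> k s' kn h; split; last exact: (field_body_ok (j := Ordinal kn)).
    by case: h => [[[r0' _ _ _] _ _ _ _] r2' _] /=; rewrite r0' r2'.
  - by move=> s' [[[r0' _ _ _] _ _ _ _] r2' _] /=; rewrite r0' r2' ltnn.
  - by split=> //=; rewrite big_pred0.
move=> {r0 c0 c1 c2 r5 r3 r1 h3 h4}s' [[[r0 c0 c1 c2] r5 r3 r1 [h3 h4]] r2 c7].
apply: runs_set_cell_seq; apply: runs_set_reg_seq.
apply: (runs_seq (Q1 := power_inv t i m)).
  apply: (runs_for (I := power_inv t i)).
  - move=> k s2 km h; split; last exact: exp_body_ok.
    by case: h => [[[_ _ _ _] r5' _ _ _] r4' _ _] /=; rewrite r5' r4'.
  - by move=> s2 [[[_ _ _ _] r5' _ _ _] r4' _ _] /=; rewrite r5' r4' ltnn.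
  - split=> //=; rewrite c7 mxE; apply: eq_bigl => b; exact: ltn_ord.
move=> {r0 c0 c1 c2 r5 r3 r1 h3 h4 r2 c7}s2 [[[r0 c0 c1 c2] r5 r3 r1 [h3 h4]] r4 c7 c8].
apply: runs_set_reg_seq.
apply: (runs_seq (Q1 := update_inv t i n)).
  apply: (runs_for (I := update_inv t i)).
  - move=> k s3 kn h; split; last exact: (update_body_ok (j := Ordinal kn)).
    by case: h => [[[r0' _ _ _] _ _ _ _] r2' _] /=; rewrite r0' r2'.
  - by move=> s3 [[[r0' _ _ _] _ _ _ _] r2' _] /=; rewrite r0' r2' ltnn.
  - by split.
move=> {r0 c0 c1 c2 r5 r3 r1 h3 h4 r4 c7 c8}s3 [[[r0 c0 c1 c2] r5 r3 r1 [h3 h4]] r2 c8].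
apply: runs_set_reg => /=; split=> //=; first by rewrite r1 addn1.
by split=> a b; rewrite ?h3 ?h4 before_row.
Qed.

Definition outer_inv t s : Prop :=
  [/\ inputs_kept s, reg s 5 = m, reg s 3 = t,
      forall a b : 'I_n, cell s 3 a b = St t a b &
      forall a b : 'I_n, cell s 4 a b = Jt t a b].

Definition step_time := (1 + ((n * row_time.+1).+1 + (tau.+1 + 1)))%N.

Lemma step_body_ok t s : outer_inv t s -> runs step_body s step_time (outer_inv t.+1).
Proof.
move=> [[r0 c0 c1 c2] r5 r3 h3 h4].
apply: runs_set_reg_seq; apply: (runs_seq (Q1 := partially_done t n 0 0)).
  apply: (runs_for (I := fun i => partially_done t i 0 0)).
  - move=> k s' kn h; split; last exact: (row_body_ok (i := Ordinal kn)).
    by case: h => [[r0' _ _ _] _ _ r1' _] /=; rewrite r0' r1'.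
  - by move=> s' [[r0' _ _ _] _ _ r1' _] /=; rewrite r0' r1' ltnn.
  - split=> //=; split=> a b.
      by rewrite h3 /before andbF.
    by rewrite h4 /before andbF.
move=> {r0 c0 c1 c2 r5 r3 h3 h4}s' [[r0 c0 c1 c2] r5 r3 r1 [h3 h4]].
apply: (runs_seq (Q1 := fun s2 => [/\ inputs_kept s2, reg s2 5 = m, reg s2 3 = t,
   forall a b : 'I_n, cell s2 3 a b = St t.+1 a b &
   forall a b : 'I_n, cell s2 4 a b = Jt t.+1 a b])).
  apply: runs_project.
  have -> : read_matrix n s' 4 = step (Jt t).
    by apply/matrixP => a b; rewrite !mxE h4 /before ltn_ord/= !mxE.
  split=> //= a b; first by rewrite h3 /before ltn_ord.
  by rewrite !valK.
move=> s2 [[r0' c0' c1' c2'] r5' r3' h3' h4']; apply: runs_set_reg.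
by split=> //=; rewrite r3' addn1.
Qed.

Lemma iterations_ok s : outer_inv 0 s ->
  runs (While (TNatLt (NReg 3) (NReg 5)) step_body) s (m * step_time.+1).+1 (outer_inv m).
Proof.
move=> h0; apply: (runs_for (I := outer_inv)) => //.
  move=> k s' km h; split; last exact: step_body_ok.
  by case: h => [_ r5 r3 _ _] /=; rewrite r5 r3.
by move=> s' [_ r5 r3 _ _] /=; rewrite r5 r3 ltnn.
Qed.

Definition step_bound : R := 1 + 4 * M +
  (16 * n%:R ^+ 3 * M ^+ 2 / eps ^+ 2 + 64 * n%:R * M ^+ 3 / eps).

Hypothesis step_bound_le : step_bound <= m%:R.
Hypothesis below_step_bound : forall k, (k < m)%N -> k%:R < step_bound.

Definition total_time :=
  (1 + ((m * 2).+1 + (tau.+1 + (m * step_time.+1).+1)))%N.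

Lemma algorithm_ok :
  runs algorithm (initial_store M eps x) total_time (fun s => result n s = St m).
Proof.
apply: runs_set_cell_seq => /=.
apply: (runs_seq (Q1 := fun s => [/\ inputs_kept s, reg s 5 = m, reg s 3 = 0%N,
    forall a b, cell s 3 a b = 0 & forall a b, cell s 4 a b = 0])).
  pose I k (s : store R) := [/\ inputs_kept s, reg s 5 = k, reg s 3 = 0%N,
    (forall a b, cell s 3 a b = 0) /\ (forall a b, cell s 4 a b = 0) &
    cell s 6 0 0 = step_bound].
  apply: (runs_weaken (Q := I m) _ (leqnn _)); last first.
    by move=> s [h1 h2 h3 [h4 h5] h6].
  apply: (runs_for (I := I)).
  - move=> k s km [[r0 c0 c1 c2] r5 r3 [h3 h4] c6]; split.
      by rewrite /= c6 r5; exact: below_step_bound.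
    by apply: runs_set_reg; split=> //=; rewrite r5 addn1.
  - by move=> s [_ r5 _ _ c6]; rewrite /= c6 r5 -leNgt.
  - split=> //=; first by split=> //= i; rewrite valK.
move=> s [[r0 c0 c1 c2] r5 r3 h3 h4].
apply: (runs_seq (Q1 := outer_inv 0)).
  apply: runs_project.
  have -> : read_matrix n s 4 = 0 by apply/matrixP => a b; rewrite !mxE h4.
  split=> //= a b; first by rewrite h3 mxE.
  by rewrite !valK.
move=> s' h0.
apply: (runs_weaken (iterations_ok h0) (leqnn _)) => s2 [_ _ _ h3' _].
by apply/matrixP => a b; rewrite mxE h3'.
Qed.

End verification.

(** * Running time and conclusion *)

Section polynomial_time.
Variable R : realType.

Lemma total_time_le n tau m : (total_time n tau m <= 33 * (n + tau + m + 1) ^ 3)%N.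
Proof.
have [z zE] : exists z, z = (n + tau + m + 1)%N by exists (n + tau + m + 1)%N.
have nz : (n <= z)%N by lia.
have tz : (tau <= z)%N by lia.
have mz : (m <= z)%N by lia.
have z0 : (0 < z)%N by lia.
rewrite -zE {zE}.
have rz : (row_time n m <= 19 * z)%N by rewrite /row_time; lia.
have sz : (step_time n tau m <= 25 * z ^ 2)%N.
  have : (n * (row_time n m).+1 <= z * (20 * z))%N by apply: leq_mul => //; lia.
  have : (z <= z ^ 2)%N by rewrite -{1}(expn1 z) leq_pexp2l.
  by rewrite /step_time; move: (n * _)%N => u; rewrite -mulnn; lia.
have : (m * (step_time n tau m).+1 <= z * (26 * z ^ 2))%N.
  apply: leq_mul => //; have : (0 < z ^ 2)%N by rewrite expn_gt0 z0.
  by lia.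
have : (z <= z ^ 3)%N by rewrite -{1}(expn1 z) leq_pexp2l.
rewrite /total_time; move: (m * (_).+1)%N => u.
have -> : (z * (26 * z ^ 2) = 26 * z ^ 3)%N by rewrite mulnCA -expnS.
by lia.
Qed.

Lemma step_bound_ub (n : nat) (M eps q : R) :
  0 < M -> 0 < eps -> 1 <= q -> n%:R <= q -> M <= q -> eps^-1 <= q ->
  step_bound n M eps <= 85 * q ^+ 7.
Proof.
move=> M0 e0 q1 nq Mq eq; have q0 : 0 <= q by lra.
have e0' : 0 <= eps^-1 by rewrite invr_ge0 ltW.
have n0 : 0 <= n%:R :> R by rewrite ler0n.
have M0' := ltW M0.
have pw k (a : R) : 0 <= a -> a <= q -> a ^+ k <= q ^+ k by move=> ? ?; apply: lerXn2r; rewrite ?nnegrE.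
have h1 : n%:R ^+ 3 * M ^+ 2 / eps ^+ 2 <= q ^+ 7.
  rewrite -exprVn (_ : q ^+ 7 = q ^+ 3 * q ^+ 2 * q ^+ 2); last by rewrite -!exprD.
  apply: ler_pM; [by rewrite mulr_ge0 ?exprn_ge0 | exact: exprn_ge0 | | exact: pw].
  by apply: ler_pM; [exact: exprn_ge0 | exact: exprn_ge0 | exact: pw | exact: pw].
have h2 : n%:R * M ^+ 3 / eps <= q ^+ 5.
  rewrite (_ : q ^+ 5 = q * q ^+ 3 * q); last by ring.
  apply: ler_pM; [by rewrite mulr_ge0 ?exprn_ge0 | exact: e0' | | exact: eq].
  by apply: ler_pM; [exact: n0 | exact: exprn_ge0 | exact: nq | exact: pw].
have h3 : q ^+ 5 <= q ^+ 7 by apply: ler_weXn2l.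
have h4 : q <= q ^+ 7 by apply: ler_eXnr.
have h5 : 1 <= q ^+ 7 by apply: exprn_ege1.
rewrite /step_bound -!mulrA in h1 h2 *; lra.
Qed.

Definition time_polynomial : {poly R} := (33 * 89 ^+ 3 : R) *: 'X^21.

Lemma total_time_poly (n tau m : nat) (M eps : R) : (0 < n)%N ->
  0 < M -> 0 < eps -> m%:R <= step_bound n M eps + 1 ->
  (total_time n tau m)%:R <= time_polynomial.[n%:R + M + eps^-1 + tau%:R].
Proof.
move=> n0 M0 e0 hm; set q := _ + tau%:R.
have e0' : 0 < eps^-1 by rewrite invr_gt0.
have n1 : 1 <= n%:R :> R by rewrite ler1n.
have t0 : 0 <= tau%:R :> R by rewrite ler0n.
have q1 : 1 <= q by rewrite /q; lra.
have hp : step_bound n M eps <= 85 * q ^+ 7.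
  by apply: step_bound_ub => //; rewrite /q; lra.
have qq : q <= q ^+ 7 by apply: ler_eXnr.
pose z := (n + tau + m + 1)%N.
have hz : z%:R <= 89 * q ^+ 7.
  have nq : n%:R + tau%:R <= q by rewrite /q; lra.
  have q7 : 1 <= q ^+ 7 by apply: exprn_ege1.
  by rewrite /z !natrD; lra.
apply: le_trans (_ : (33 * z ^ 3)%N%:R <= _); first by rewrite ler_nat total_time_le.
rewrite hornerZ hornerXn natrM natrX -mulrA; apply: ler_wpM2l => //.
rewrite (_ : 89 ^+ 3 * q ^+ 21 = (89 * q ^+ 7) ^+ 3); last by rewrite exprMn -exprM.
by apply: lerXn2r; rewrite ?nnegrE ?ler0n//; apply: le_trans hz.
Qed.

End polynomial_time.

Section minimizers.
Variable R : realType.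

(** When no minimizer exists, a near-minimizer comes from the infimum. *)
Lemma near_minimizer_exists (T : Type) (f : T -> R) (J : set T) (eta : R) :
  0 < eta -> J !=set0 -> (forall A, 0 <= f A) ->
  exists A, near_minimizer eta f J A /\
    ((exists B, minimizer f J B) -> minimizer f J A).
Proof.
move=> e0 [A0 JA0] f0.
have [[B mB]|nB] := pselect (exists B, minimizer f J B).
  exists B; split=> //; have [JB h] := mB; split=> // A /h hA.
  by apply: le_trans hA _; rewrite lerDl ltW.
have hi : has_inf (f @` J).
  by split; [exists (f A0), A0 | exists 0 => _ [A _ <-]].
have [_ [A JA <-] hA] := inf_adherent e0 hi.
exists A; split; last by move=> /nB.
split=> // B JB; apply: le_trans (ltW hA) _; rewrite lerD2r.
by apply: ge_inf; [have [] := hi | exists B].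
Qed.

End minimizers.

Theorem theorem1 (R : realType) :
  exists (C : R -> R) (eta : R) (phi : forall n, config n -> 'M[R]_n -> R)
         (algo : program) (p : {poly R}),
  [/\ singly_exponential C,
      0 < eta,
      forall n (x : config n), convex_function setT (phi n x) &
      forall (M : R) (n : nat) (J : set 'M[R]_n),
      0 < M -> (3 <= n)%N -> J !=set0 ->
      (forall A, J A -> interaction_matrix A /\ infinity_norm A <= M) ->
      [/\ exists Jhat : config n -> 'M[R]_n, forall x,
            near_minimizer eta (phi n x) J (Jhat x) /\
            ((exists A, minimizer (phi n x) J A) ->
             minimizer (phi n x) J (Jhat x)),
          forall Jhat : config n -> 'M[R]_n,
            (forall x, near_minimizer eta (phi n x) J (Jhat x)) ->
            forall (Jstar : 'M[R]_n) (delta : R),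
            J Jstar -> 0 < delta -> delta < 1 ->
            1 - delta <= ising_prob Jstar (fun x =>
              frobenius_norm (Jhat x - Jstar) <=
              C M * Num.sqrt
                (ln (covering_number (@spectral_norm R n) J n%:R^-1)%:R
                 + ln delta^-1 + ln (ln n%:R))) &
          convex_set J ->
          forall P : 'M[R]_n -> 'M[R]_n, projection_onto J P ->
          forall (tau : nat) (eps : R) (x : config n), 0 < eps ->
          exists (t : nat) (s : store R),
          [/\ exec P tau algo (initial_store M eps x) t s,
              t%:R <= p.[n%:R + M + eps^-1 + tau%:R] &
              near_minimizer eps (phi n x) J (result n s)]]].
Proof.
exists (@rate R), 1, (@pseudo_loss R), algorithm, (time_polynomial R); split=> //.
- exact: rate_singly_exponential.
- move=> n x t A B _ _; apply: pseudo_loss_convex; [exact: ge0 | exact: le1].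
move=> M n J M0 n3 J0 bJ; split.
- have := fun x => near_minimizer_exists ltr01 J0 (@pseudo_loss_ge0 R n x).
  by move=> /choice[Jhat h]; exists Jhat.
- move=> Jhat hJ Jstar delta; exact: near_minimizer_error.
move=> cJ P projP tau eps x e0.
have n0 : (0 < n)%N by apply: leq_trans n3.
have nR : 0 < n%:R :> R by rewrite ltr0n.
have bound A : J A -> rowsum_le M A.
  by move=> /bJ[_] h; apply/infinity_normP => //; exact: ltW.
have ex : exists m, step_bound n M eps <= m%:R.
  by exists (Num.truncn (step_bound n M eps)).+1; apply: ltW; exact: truncnS_gt.
have [m hm mmin] := ex_minnP ex.
have below k : (k < m)%N -> k%:R < step_bound n M eps.
  by move=> km; rewrite ltNge; apply/negP => /mmin; rewrite leqNgt km.
have p0 : 0 <= 16 * n%:R ^+ 3 * M ^+ 2 / eps ^+ 2.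
  apply: divr_ge0 (sqr_ge0 _); apply: mulr_ge0 (sqr_ge0 _).
  by apply: mulr_ge0; [exact: ler0n | exact: exprn_ge0 (ltW nR)].
have p1 : 0 <= 64 * n%:R * M ^+ 3 / eps.
  apply: divr_ge0 (ltW e0); apply: mulr_ge0 (exprn_ge0 _ (ltW M0)).
  by apply: mulr_ge0; exact: ler0n.
have m1 : m%:R <= step_bound n M eps + 1.
  case: (m) below => [|k] below; first by rewrite /step_bound; lra.
  by rewrite -natr1 lerD2r ltW// below.
have [t [s [run tT res]]] := algorithm_ok P tau x hm below.
exists t, s; split=> //.
  by apply: le_trans (total_time_poly tau n0 M0 e0 m1); rewrite ler_nat.
have step0 : 0 < eps / (4 * n%:R ^+ 2) by rewrite divr_gt0// mulr_gt0// exprn_gt0.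
have mM : 4 * M <= m%:R by apply: le_trans hm; rewrite /step_bound; lra.
rewrite res; apply: (average_near_minimizer cJ projP x M0 step0 bound mM e0 n0 erefl).
by apply: le_trans hm; rewrite /step_bound; lra.
Qed.
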